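(* Let $M$ be a smooth manifold of dimension $n$. There is a one to one correspondence between $\mathcal{B}(M)$ and $\Omega^\bullet(M):=\bigoplus_{k=0}^n\Omega^k(M)$. This correspondence is given by associating $\eta\in\mathcal{B}(M)$ with $\{\omega^{(k)}\}_{k=0}^n$, where (1) $\omega^{(k)}\in\Omega^k(M)$ for $k=0,\dots,n$; (2) $\eta(x,y)=\omega^{(k+l)}(x\wedge y)$ for all $x\in\wedge^kT_pM$, $y\in\wedge^lT_pM$, $p\in M$, $1\le k+l\le n$; and (3) $\eta(x,y)=(xy)\,\omega^{(0)}_p$ for all $x,y\in\wedge^0T_pM:=\mathbb{R}$, $p\in M$.
   Context: $\mathcal{B}(M)$ is the set of all fiberwise $\mathbb{R}$-bilinear forms $\eta$ on the exterior bundle $\wedge^\bullet TM$ such that (i) $\eta(x\wedge y,z)=\eta(x,y\wedge z)$ for all $x\in\wedge^kT_pM$, $y\in\wedge^lT_pM$, $z\in\wedge^mT_pM$, $p\in M$, $k,l,m\ge0$; (ii) $\eta$ is smooth: for all $X\in\Gamma(\wedge^kTM)$, $Y\in\Gamma(\wedge^lTM)$ the function $p\mapsto\eta(X_p,Y_p)$ is smooth. A $k$-form is evaluated on $k$-vectors through the natural isomorphism $\wedge^kT_p^\ast M\cong(\wedge^kT_pM)^\ast$, $(\omega^1\wedge\cdots\wedge\omega^k)(v_1\wedge\cdots\wedge v_k)=\det(\omega^i(v_j))$. *)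

(* Defs.v *)
From HB Require Import structures.
From mathcomp Require Import all_boot all_order all_algebra.
From mathcomp Require Import generic_quotient finmap monalg.
From mathcomp Require Import all_classical all_reals all_analysis.

Set Implicit Arguments.
Unset Strict Implicit.
Unset Printing Implicit Defensive.

Import Order.TTheory GRing.Theory Num.Theory.
Import numFieldNormedType.Exports.

Local Open Scope quotient_scope.
Local Open Scope classical_set_scope.
Local Open Scope ring_scope.

Section ExteriorAlgebra.
Variables (R : fieldType) (V : lmodType R).

(* The free unital algebra on the set V: the monomials are the finite words
   in the elements of V. *)
Local Notation freealg := {malg R[{fmonom V}]}.

Definition free_gen (v : V) : freealg := << fmu v >>.

(* Two-sided ideal generated by the relations making [free_gen] linear (which
   yields the tensor algebra) and by the squares v * v. *)
Inductive ext_rel : freealg -> Prop :=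
| ext_rel_linear a u v :
    ext_rel (free_gen (a *: u + v) - (a *: free_gen u + free_gen v))
| ext_rel_square v : ext_rel (free_gen v * free_gen v)
| ext_rel0 : ext_rel 0
| ext_relB x y : ext_rel x -> ext_rel y -> ext_rel (x - y)
| ext_relMl x y : ext_rel y -> ext_rel (x * y)
| ext_relMr x y : ext_rel x -> ext_rel (x * y).

Definition ext_ideal : {pred freealg} := fun x => `[< ext_rel x >].

Lemma ext_idealP x : reflect (ext_rel x) (x \in ext_ideal).
Proof. exact: asboolP. Qed.

Lemma ext_ideal_zmod_closed : zmod_closed ext_ideal.
Proof.
split; first exact/ext_idealP/ext_rel0.
by move=> x y /ext_idealP hx /ext_idealP hy; exact/ext_idealP/ext_relB.
Qed.

HB.instance Definition _ :=
  GRing.isZmodClosed.Build freealg ext_ideal ext_ideal_zmod_closed.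

Definition extalg := {ideal_quot ext_ideal}.
HB.instance Definition _ := GRing.Zmodule.on extalg.

Definition ext_pi (x : freealg) : extalg := \pi_({ideal_quot ext_ideal}) x.

Lemma ext_pi_eq x y : (ext_pi x = ext_pi y) <-> (x - y \in ext_ideal).
Proof.
by rewrite Quotient.idealrBE; split=> [h|/eqP//]; exact/eqP.
Qed.

Lemma ext_piK x : ext_pi (repr x) = x.
Proof. exact: reprK. Qed.

Lemma ext_pi_ind (P : extalg -> Prop) :
  (forall x, P (ext_pi x)) -> forall x, P x.
Proof. by move=> h x; rewrite -[x]ext_piK. Qed.

Lemma ext_repr x : repr (ext_pi x) - x \in ext_ideal.
Proof. by apply/ext_pi_eq; rewrite ext_piK. Qed.

Lemma ext_piB : {morph ext_pi : x y / x - y}.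
Proof. exact: raddfB. Qed.

Lemma ext_piD : {morph ext_pi : x y / x + y}.
Proof. exact: raddfD. Qed.

Definition ext_one : extalg := ext_pi 1.
Definition ext_mul (x y : extalg) : extalg := ext_pi (repr x * repr y).
Definition ext_scale (a : R) (x : extalg) : extalg := ext_pi (a *: repr x).

Lemma ext_pi_mul x y : ext_mul (ext_pi x) (ext_pi y) = ext_pi (x * y).
Proof.
apply/ext_pi_eq; set x' := repr _; set y' := repr _.
have -> : x' * y' - x * y = (x' - x) * y' + x * (y' - y).
  by rewrite mulrBl mulrBr addrA subrK.
rewrite rpredD //; apply/ext_idealP.
  exact/ext_relMr/ext_idealP/ext_repr.
exact/ext_relMl/ext_idealP/ext_repr.
Qed.

Lemma ext_pi_scale a x : ext_scale a (ext_pi x) = ext_pi (a *: x).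
Proof.
apply/ext_pi_eq; rewrite -scalerBr -[_ - _]mul1r scalerAl.
exact/ext_idealP/ext_relMl/ext_idealP/ext_repr.
Qed.

Lemma ext_mulA : associative ext_mul.
Proof.
elim/ext_pi_ind => x; elim/ext_pi_ind => y; elim/ext_pi_ind => z.
by rewrite !ext_pi_mul mulrA.
Qed.

Lemma ext_mul1l : left_id ext_one ext_mul.
Proof. by elim/ext_pi_ind => x; rewrite ext_pi_mul mul1r. Qed.

Lemma ext_mul1r : right_id ext_one ext_mul.
Proof. by elim/ext_pi_ind => x; rewrite ext_pi_mul mulr1. Qed.

Lemma ext_mulDl : left_distributive ext_mul +%R.
Proof.
elim/ext_pi_ind => x; elim/ext_pi_ind => y; elim/ext_pi_ind => z.
by rewrite -ext_piD !ext_pi_mul -ext_piD mulrDl.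
Qed.

Lemma ext_mulDr : right_distributive ext_mul +%R.
Proof.
elim/ext_pi_ind => x; elim/ext_pi_ind => y; elim/ext_pi_ind => z.
by rewrite -ext_piD !ext_pi_mul -ext_piD mulrDr.
Qed.

Let coeff1 (x : freealg) : R := mcoeff (@mone {fmonom V}) x.

Lemma ext_rel_coeff1 x : ext_rel x -> coeff1 x = 0.
Proof.
have gen0 v : coeff1 (free_gen v) = 0.
  by rewrite /coeff1 /free_gen mcoeffU1 -val_eqE /= fmU fm1.
have cB y z : coeff1 (y - z) = coeff1 y - coeff1 z by exact: mcoeffB.
have cD y z : coeff1 (y + z) = coeff1 y + coeff1 z by exact: mcoeffD.
have cZ a y : coeff1 (a *: y) = a * coeff1 y by exact: mcoeffZ.
have cM y z : coeff1 (y * z) = coeff1 y * coeff1 z.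
  by case: (mcoeff1g_is_multiplicative {fmonom V} R) => h _; exact: h.
elim=> {x} [a u v|v||x y _ hx _ hy|x y _ h|x y _ h].
- by rewrite cB cD cZ !gen0 mulr0 addr0 subrr.
- by rewrite cM gen0 mulr0.
- exact: mcoeff0.
- by rewrite cB hx hy subrr.
- by rewrite cM h mulr0.
- by rewrite cM h mul0r.
Qed.

Lemma ext_one_neq0 : ext_one != 0.
Proof.
apply/eqP => h; have : ext_pi 1 = ext_pi 0.
  by rewrite -/ext_one h; apply/esym/raddf0.
move/ext_pi_eq; rewrite subr0 => /ext_idealP /ext_rel_coeff1.
by rewrite /coeff1 mcoeff1 eqxx => /eqP; rewrite oner_eq0.
Qed.

HB.instance Definition _ := GRing.Zmodule_isNzRing.Build extalg
  ext_mulA ext_mul1l ext_mul1r ext_mulDl ext_mulDr ext_one_neq0.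

Lemma ext_scaleA a b x : ext_scale a (ext_scale b x) = ext_scale (a * b) x.
Proof. by elim/ext_pi_ind: x => x; rewrite !ext_pi_scale scalerA. Qed.

Lemma ext_scale1 : left_id 1 ext_scale.
Proof. by elim/ext_pi_ind => x; rewrite ext_pi_scale scale1r. Qed.

Lemma ext_scaleDr : right_distributive ext_scale +%R.
Proof.
move=> a; elim/ext_pi_ind => x; elim/ext_pi_ind => y.
by rewrite -ext_piD !ext_pi_scale -ext_piD scalerDr.
Qed.

Lemma ext_scaleDl x : {morph ext_scale^~ x : a b / a + b}.
Proof.
by move=> a b /=; elim/ext_pi_ind: x => x; rewrite !ext_pi_scale -ext_piD scalerDl.
Qed.

HB.instance Definition _ := GRing.Zmodule_isLmodule.Build R extalg
  ext_scaleA ext_scale1 ext_scaleDr ext_scaleDl.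

Lemma ext_scaleAl a (x y : extalg) : a *: (x * y) = (a *: x) * y.
Proof.
elim/ext_pi_ind: x => x; elim/ext_pi_ind: y => y.
rewrite /GRing.mul /= ext_pi_mul /GRing.scale /= !ext_pi_scale ext_pi_mul.
by rewrite scalerAl.
Qed.

HB.instance Definition _ := GRing.Lmodule_isLalgebra.Build R extalg ext_scaleAl.

Lemma free_scaleAr a (x y : freealg) : a *: (x * y) = x * (a *: y).
Proof.
apply/malgP => k.
rewrite (mcoeffMlw k (fsubset_refl _) (msuppZ_le a y)) mcoeffZ mcoeffMl.
rewrite mulr_sumr; apply: eq_bigr => k1 _.
rewrite mulr_sumr; apply: eq_bigr => k2 _.
by rewrite mcoeffZ mulrnAr mulrCA.
Qed.

Lemma ext_scaleAr a (x y : extalg) : a *: (x * y) = x * (a *: y).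
Proof.
elim/ext_pi_ind: x => x; elim/ext_pi_ind: y => y.
rewrite /GRing.mul /= ext_pi_mul /GRing.scale /= !ext_pi_scale ext_pi_mul.
by rewrite free_scaleAr.
Qed.

HB.instance Definition _ := GRing.Lalgebra_isAlgebra.Build R extalg ext_scaleAr.

Definition ext_gen (v : V) : extalg := ext_pi (free_gen v).

Lemma ext_gen_linear : linear ext_gen.
Proof.
move=> a u v; rewrite /ext_gen /GRing.scale /= ext_pi_scale -ext_piD.
exact/ext_pi_eq/ext_idealP/ext_rel_linear.
Qed.

Lemma ext_gen_sqr v : ext_gen v * ext_gen v = 0.
Proof.
rewrite [LHS]ext_pi_mul -[RHS](raddf0 (\pi_({ideal_quot ext_ideal}))).
by apply/ext_pi_eq; rewrite subr0; exact/ext_idealP/ext_rel_square.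
Qed.

(* Span of the products of k vectors; in particular extpow 0 is the line
   of scalars. *)
Definition extpow (k : nat) : set extalg :=
  [set x | exists (r : nat) (c : 'I_r -> R) (v : 'I_r -> k.-tuple V),
     x = \sum_(i < r) c i *: \prod_(u <- v i) ext_gen u].

End ExteriorAlgebra.


Section Dual.
Variables (R : fieldType) (V : lmodType R).

Definition dual_pred : {pred V -> R^o} := fun f => `[< scalar f >].

Lemma dual_submod_closed : submod_closed dual_pred.
Proof.
split; first by apply/asboolP => a u v /=; rewrite mulr0 addr0.
move=> a f g /asboolP hf /asboolP hg; apply/asboolP => b u v.
rewrite !fctE /= hf hg /GRing.scale /= !mulrDr !mulrA [b * a]mulrC.
by rewrite -!addrA; congr (_ + _); rewrite addrCA.
Qed.

HB.instance Definition _ :=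
  GRing.isSubmodClosed.Build R (V -> R^o) dual_pred dual_submod_closed.

Record dual := Dual { dual_fun :> V -> R^o; _ : dual_fun \in dual_pred }.

HB.instance Definition _ := [isSub for dual_fun].
HB.instance Definition _ := [Choice of dual by <:].
HB.instance Definition _ := [SubChoice_isSubLmodule of dual by <:].

Lemma dual_scalar (f : dual) : scalar f.
Proof. exact/asboolP/(valP f). Qed.

(* Pairing of a word of covectors with a word of vectors, and its bilinear
   extension to the free algebras. *)
Definition word_pairing (a : seq dual) (b : seq V) : R :=
  if size a == size b then
    \det (\matrix_(i < size a, j < size a) (nth 0 a i : dual) (nth 0 b j))
  else 0.

Definition free_pairing
    (x : {malg R[{fmonom dual}]}) (y : {malg R[{fmonom V}]}) : R :=
  \sum_(a <- msupp x) \sum_(b <- msupp y) x@_a * y@_b * word_pairing a b.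

(* Evaluation of forms on multivectors. It does not depend on the
   representatives ([ext_eval_pi]); it is given by determinants on products
   ([ext_eval_det]) and vanishes between different degrees. *)
Definition ext_eval (x : extalg dual) (y : extalg V) : R :=
  free_pairing (repr x) (repr y).

End Dual.

Section LinearExtension.
Variables (R : fieldType) (V : lmodType R).
Local Notation freealg := {malg R[{fmonom V}]}.
Implicit Types (x y : freealg) (F : seq V -> R).

Definition word_lift F x : R := \sum_(a <- msupp x) x@_a * F a.

Lemma word_liftE (d : {fset {fmonom V}}) F x : (msupp x `<=` d)%fset ->
  word_lift F x = \sum_(a <- d) x@_a * F a.
Proof.
move=> sd; rewrite /word_lift; apply: big_fset_incl => // a _ /mcoeff_outdom ->.
by rewrite mul0r.
Qed.

Lemma word_liftP F : scalar (word_lift F).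
Proof.
move=> c x y; pose d := (msupp x `|` msupp y `|` msupp (c *: x + y))%fset.
have hx : (msupp x `<=` d)%fset by rewrite /d -fsetUA fsubsetUl.
have hy : (msupp y `<=` d)%fset by rewrite /d fsetUAC fsubsetUr.
rewrite (word_liftE F hx) (word_liftE F hy) (@word_liftE d) ?fsubsetUr //.
rewrite mulr_sumr -big_split /=; apply: eq_bigr => a _.
by rewrite mcoeffD mcoeffZ mulrDl mulrA.
Qed.

HB.instance Definition _ F :=
  GRing.isLinear.Build R freealg R *%R (word_lift F) (word_liftP F).

Lemma word_liftU F c (a : {fmonom V}) : word_lift F << c *g a >> = c * F a.
Proof.
by rewrite (word_liftE F msuppU_le) big_seq_fset1 mcoeffUU.
Qed.

Lemma word_liftM F x y : word_lift F (x * y) =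
  word_lift (fun a => word_lift (fun b => F (a ++ b)) y) x.
Proof.
rewrite malgME raddf_sum; apply: eq_bigr => a _.
rewrite raddf_sum mulr_sumr; apply: eq_bigr => b _.
by rewrite /= word_liftU fmM mulrA.
Qed.

Lemma word_liftMr F x y : word_lift F (x * y) =
  word_lift (fun b => word_lift (fun a => F (a ++ b)) x) y.
Proof.
rewrite word_liftM /word_lift; under eq_bigr do rewrite mulr_sumr.
rewrite exchange_big /=; apply: eq_bigr => b _; rewrite mulr_sumr.
by apply: eq_bigr => a _; rewrite mulrCA.
Qed.

Definition alternating F :=
  (forall p q c u v, F (p ++ (c *: u + v) :: q) =
     c * F (p ++ u :: q) + F (p ++ v :: q)) /\
  (forall p q v, F (p ++ v :: v :: q) = 0).

Lemma word_lift0 F x : (forall a, F a = 0) -> word_lift F x = 0.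
Proof. by move=> h; rewrite /word_lift big1 // => a _; rewrite h mulr0. Qed.

Lemma word_lift_rel x : ext_rel x ->
  forall F, alternating F -> word_lift F x = 0.
Proof.
elim=> {x} [c u v|v||x y _ hx _ hy|x y _ h|x y _ h] F [F1 F2].
- rewrite raddfB raddfD /= linearZ /= !word_liftU !fmU !mul1r.
  by rewrite (F1 [::] [::]) subrr.
- rewrite word_liftM word_liftU mul1r fmU word_liftU fmU mul1r.
  exact: (F2 [::] [::]).
- exact: raddf0.
- by rewrite raddfB /= hx ?hy ?subrr.
- rewrite word_liftM word_lift0 // => a; apply: h; split.
    by move=> p q c u v; rewrite !catA F1.
  by move=> p q v; rewrite catA F2.
- rewrite word_liftMr word_lift0 // => a; apply: h; split.
    by move=> p q c u v; rewrite -!catA F1.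
  by move=> p q v; rewrite -catA F2.
Qed.

Lemma word_lift_pi F x y : alternating F -> ext_pi x = ext_pi y ->
  word_lift F x = word_lift F y.
Proof.
move=> altF /ext_pi_eq /ext_idealP /word_lift_rel /(_ _ altF).
by rewrite raddfB => /subr0_eq.
Qed.

End LinearExtension.

Section Evaluation.
Variables (R : fieldType) (V : lmodType R).

Lemma free_pairingE (x : {malg R[{fmonom dual V}]}) (y : {malg R[{fmonom V}]}) :
  free_pairing x y = word_lift (fun a => word_lift (word_pairing a) y) x.
Proof.
by apply: eq_bigr => a _; rewrite mulr_sumr; apply: eq_bigr => b _; rewrite mulrA.
Qed.

Lemma free_pairingEr (x : {malg R[{fmonom dual V}]}) (y : {malg R[{fmonom V}]}) :
  free_pairing x y =
  word_lift (fun b => word_lift (fun a => word_pairing a b) x) y.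
Proof.
rewrite /free_pairing exchange_big; apply: eq_bigr => b _; rewrite mulr_sumr.
by apply: eq_bigr => a _; rewrite mulrA [y@__ * _]mulrC.
Qed.

Lemma nth_mid (T : Type) (x0 u v : T) p q i : i != size p ->
  nth x0 (p ++ u :: q) i = nth x0 (p ++ v :: q) i.
Proof.
rewrite !nth_cat neq_ltn; case: ltnP => //= h /= hi.
by rewrite -[(i - size p)%N]prednK ?subn_gt0.
Qed.

Lemma nth_mids (T : Type) (x0 u : T) p q : nth x0 (p ++ u :: q) (size p) = u.
Proof. by rewrite nth_cat ltnn subnn. Qed.

Lemma word_pairing_altl (b : seq V) :
  alternating (fun a : seq (dual V) => word_pairing a b).
Proof.
split=> [p q c u v|p q v]; rewrite /word_pairing !size_cat /=; last first.
  case: eqP => // _.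
  have lt1 : (size p < size p + (size q).+2)%N by rewrite -addSnnS leq_addr.
  have lt2 : ((size p).+1 < size p + (size q).+2)%N by rewrite -!addSnnS leq_addr.
  apply: (@determinant_alternate _ _ _ (Ordinal lt1) (Ordinal lt2)).
    by rewrite -val_eqE /= neq_ltn ltnSn.
  move=> j; rewrite !mxE /= nth_mids -cat_rcons -(size_rcons p v).
  by rewrite nth_mids.
case: eqP => // _; last by rewrite mulr0 addr0.
have lt1 : (size p < size p + (size q).+1)%N by rewrite -addSnnS leq_addr.
rewrite -[X in _ = _ + X]mul1r; apply: (@determinant_multilinear _ _ _ _ _ (Ordinal lt1)).
- apply/rowP => j; rewrite !mxE /= !nth_mids mul1r.
  by rewrite -[LHS]/((c *: dual_fun u + dual_fun v) _).
- apply/matrixP => i j; rewrite !mxE; congr (dual_fun _ _); apply: nth_mid.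
  by rewrite -[size p]/(nat_of_ord (Ordinal lt1)) eq_sym neq_lift.
- apply/matrixP => i j; rewrite !mxE; congr (dual_fun _ _); apply: nth_mid.
  by rewrite -[size p]/(nat_of_ord (Ordinal lt1)) eq_sym neq_lift.
Qed.

Lemma word_pairing_altr (a : seq (dual V)) : alternating (word_pairing a).
Proof.
split=> [p q c u v|p q v]; rewrite /word_pairing !size_cat /=; last first.
  case: eqP => // sa.
  have lt1 : (size p < size a)%N by rewrite sa -addSnnS leq_addr.
  have lt2 : ((size p).+1 < size a)%N by rewrite sa -!addSnnS leq_addr.
  rewrite -det_tr.
  apply: (@determinant_alternate _ _ _ (Ordinal lt1) (Ordinal lt2)).
    by rewrite -val_eqE /= neq_ltn ltnSn.
  move=> j; rewrite !mxE /= nth_mids -cat_rcons -(size_rcons p v).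
  by rewrite nth_mids.
case: eqP => // sa; last by rewrite mulr0 addr0.
have lt1 : (size p < size a)%N by rewrite sa -addSnnS leq_addr.
rewrite -[X in _ = _ + X]mul1r -det_tr -[X in _ = _ * X + _]det_tr.
rewrite -[X in _ = _ + _ * X]det_tr.
apply: (@determinant_multilinear _ _ _ _ _ (Ordinal lt1)).
- by apply/rowP => j; rewrite !mxE /= !nth_mids mul1r dual_scalar.
- apply/matrixP => i j; rewrite !mxE; congr (dual_fun _ _); apply: nth_mid.
  by rewrite -[size p]/(nat_of_ord (Ordinal lt1)) eq_sym neq_lift.
- apply/matrixP => i j; rewrite !mxE; congr (dual_fun _ _); apply: nth_mid.
  by rewrite -[size p]/(nat_of_ord (Ordinal lt1)) eq_sym neq_lift.
Qed.

Lemma ext_eval_pi (x : {malg R[{fmonom dual V}]}) (y : {malg R[{fmonom V}]}) :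
  ext_eval (ext_pi x) (ext_pi y) = free_pairing x y.
Proof.
rewrite /ext_eval free_pairingE (@word_lift_pi _ _ _ _ x) ?ext_piK //; last first.
  split=> [p q c u v|p q v]; last first.
    by apply: big1 => b _; rewrite (word_pairing_altl b).2 mulr0.
  rewrite /word_lift mulr_sumr -big_split /=; apply: eq_bigr => b _.
  by rewrite (word_pairing_altl b).1 mulrDr mulrCA.
rewrite -free_pairingE free_pairingEr [RHS]free_pairingEr.
apply: word_lift_pi; rewrite ?ext_piK //.
split=> [p q c u v|p q v]; last first.
  by apply: big1 => a _; rewrite (word_pairing_altr a).2 mulr0.
rewrite /word_lift mulr_sumr -big_split /=; apply: eq_bigr => a _.
by rewrite (word_pairing_altr a).1 mulrDr mulrCA.
Qed.

Lemma ext_prod_gen (W : lmodType R) (s : seq W) :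
  \prod_(u <- s) ext_gen u = ext_pi << FMonom s >>.
Proof.
elim: s => [|u s ih].
  rewrite big_nil /GRing.one /= /ext_one; congr ext_pi.
  by rewrite -fmoneE.
rewrite big_cons ih [LHS]ext_pi_mul; congr ext_pi.
rewrite malgM_def fgmulUU mulr1; congr << _ >>.
by apply: val_inj; rewrite /= fmM fmU.
Qed.

Lemma ext_eval_det k (w : k.-tuple (dual V)) (v : k.-tuple V) :
  ext_eval (\prod_(f <- w) ext_gen f) (\prod_(u <- v) ext_gen u) =
  \det (\matrix_(i < k, j < k) (tnth w i : dual V) (tnth v j)).
Proof.
rewrite !ext_prod_gen ext_eval_pi free_pairingE !word_liftU !mul1r.
rewrite /word_pairing /= !size_tuple eqxx.
by congr (\det _); apply/matrixP => i j; rewrite !mxE !(tnth_nth 0).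
Qed.

End Evaluation.


Section Smooth.
Variables (R : realType) (V W : normedModType R).

(* f is of class C^k on the open set U: a C^(k+1) map is a differentiable one
   whose directional derivatives are all C^k. *)
Fixpoint C_on (k : nat) (U : set V) (f : V -> W) : Prop :=
  if k is k'.+1 then
    (forall x, U x -> differentiable f x) /\ (forall v, C_on k' U ('D_v f))
  else forall x, U x -> {for x, continuous f}.

Definition smooth_on (U : set V) (f : V -> W) := forall k, C_on k U f.

End Smooth.

(* The smooth structure is given by any smooth atlas, maximal or not: tangent
   vectors and smoothness depend only on the maximal atlas it generates.
   Outside [chart_dom i] and its image, [chart i] and [chart_inv i] are
   arbitrary. *)
Record smooth_manifold (R : realType) (n : nat) := SmoothManifold {
  mfd_pt :> topologicalType;
  mfd_hausdorff : hausdorff_space mfd_pt;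
  mfd_second_countable : @second_countable mfd_pt;
  mfd_idx : Type;
  chart_dom : mfd_idx -> set mfd_pt;
  chart : mfd_idx -> mfd_pt -> 'rV[R]_n;
  chart_inv : mfd_idx -> 'rV[R]_n -> mfd_pt;
  chart_dom_open : forall i, open (chart_dom i);
  chart_img_open : forall i, open (chart i @` chart_dom i);
  chart_continuous : forall i, {in chart_dom i, continuous (chart i)};
  chart_inv_continuous :
    forall i, {in chart i @` chart_dom i, continuous (chart_inv i)};
  chartK : forall i, {in chart_dom i, cancel (chart i) (chart_inv i)};
  chart_cover : forall p, exists i, chart_dom i p;
  chart_smooth : forall i j,
    smooth_on (chart i @` (chart_dom i `&` chart_dom j))
              (chart j \o chart_inv i)
}.

Section Tangent.
Variables (R : realType) (n : nat) (M : smooth_manifold R n).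
Implicit Types (i j : mfd_idx M) (p : M).

Definition smooth_fun_on (A : set M) (f : M -> R) :=
  forall i,
    smooth_on (chart i @` (A `&` chart_dom i)) (f \o chart_inv i : _ -> R^o).

Definition transition i j p : {linear 'rV[R]_n -> 'rV[R]_n} :=
  'd (chart j \o chart_inv i) (chart i p).

(* A tangent vector at p is given by its components in every chart around p,
   which are related by the differentials of the changes of coordinates; the
   components in the charts not containing p are set to 0. *)
Definition tangent_pred p : {pred mfd_idx M -> 'rV[R]_n} := fun v =>
  `[< (forall i, ~ chart_dom i p -> v i = 0) /\
      (forall i j, chart_dom i p -> chart_dom j p ->
         v j = transition i j p (v i)) >].

Lemma tangent_submod_closed p : submod_closed (tangent_pred p).
Proof.
split; first by apply/asboolP; split=> // i j _ _; rewrite linear0.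
move=> a u v /asboolP[u0 uT] /asboolP[v0 vT]; apply/asboolP; split.
  by move=> i ni; rewrite !fctE u0 // v0 // scaler0 addr0.
by move=> i j hi hj; rewrite !fctE linearP (uT i j) // (vT i j).
Qed.

HB.instance Definition _ p := GRing.isSubmodClosed.Build R
  (mfd_idx M -> 'rV[R]_n) (tangent_pred p) (tangent_submod_closed p).

Record tangent p := Tangent {
  tcoord :> mfd_idx M -> 'rV[R]_n; _ : tcoord \in tangent_pred p }.

HB.instance Definition _ p := [isSub for @tcoord p].
HB.instance Definition _ p := [Choice of tangent p by <:].
HB.instance Definition _ p := [SubChoice_isSubLmodule of tangent p by <:].

Lemma transition_chain i j k p :
  chart_dom i p -> chart_dom j p -> chart_dom k p ->
  transition i k p =1 transition j k p \o transition i j p.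
Proof.
move=> hi hj hk w.
have dif a b : chart_dom a p -> chart_dom b p ->
    differentiable (chart b \o chart_inv a) (chart a p).
  by move=> ha hb; have [+ _] := chart_smooth (s:=M) a b 1; apply; exists p.
have pK : chart_inv i (chart i p) = p by rewrite chartK ?inE.
have E : {near chart i p, chart k \o chart_inv i =1
    (chart k \o chart_inv j) \o (chart j \o chart_inv i)}.
  have ci : {for chart i p, continuous (chart_inv i)}.
    by apply: chart_inv_continuous; rewrite inE; exists p.
  have : \forall y \near chart i p, chart_dom j (chart_inv i y).
    by apply: ci; rewrite pK; apply: open_nbhs_nbhs; split => //; exact: chart_dom_open.
  by apply: filterS => y hy /=; rewrite chartK ?inE.
have dij := dif _ _ hi hj; have dik := dif _ _ hi hk.
have djk : differentiable (chart k \o chart_inv j)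
    ((chart j \o chart_inv i) (chart i p)).
  by rewrite /= pK; exact: dif.
have dc := differentiable_comp dij djk.
transitivity ('D_w (chart k \o chart_inv i) (chart i p)).
  exact: (esym (deriveE w dik)).
rewrite (near_eq_derive _ E).
transitivity ('d ((chart k \o chart_inv j) \o (chart j \o chart_inv i))
    (chart i p) w); first exact: (deriveE w dc).
have Ep : (chart j \o chart_inv i) (chart i p) = chart j p by rewrite /= pK.
have dE := diff_comp dij djk.
rewrite Ep in dE.
have := congr1 (@^~ w) dE.
exact.
Qed.

(* The tangent vector d/dx^a at p, in the chart i. *)
Definition coord_vec_fun i p (a : 'I_n) : mfd_idx M -> 'rV[R]_n := fun j =>
  if `[< chart_dom i p /\ chart_dom j p >]
  then transition i j p (delta_mx 0 a) else 0.

Lemma coord_vec_subproof i p a : coord_vec_fun i p a \in tangent_pred p.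
Proof.
apply/asboolP; split=> [j nj|j k hj hk]; rewrite /coord_vec_fun.
  by case: asboolP => // -[].
have [hi|ni] := pselect (chart_dom i p).
  by rewrite !asboolT //; exact: transition_chain.
by rewrite !asboolF ?linear0 // => -[].
Qed.

Definition coord_vec i p a : tangent p := Tangent (coord_vec_subproof i p a).

(* The covector dx^a at p, in the chart i. *)
Lemma coord_covec_subproof i p (a : 'I_n) :
  (fun v : tangent p => v i 0 a : R^o) \in @dual_pred R (tangent p).
Proof. by apply/asboolP => c u v; rewrite /= !mxE. Qed.

Definition coord_covec i p a : dual (tangent p) :=
  Dual (coord_covec_subproof i p a).

Definition ext_frame (V : lmodType R) (e : 'I_n -> V) (A : {set 'I_n}) :
  extalg V := \prod_(a in A) ext_gen (e a).

(* Smooth sections of the k-th exterior power of TM or T*M, for e the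
   coordinate frames of the bundle. *)
Definition bundle_section (V : M -> lmodType R)
    (e : mfd_idx M -> forall p, 'I_n -> V p) (k : nat)
    : set (forall p, extalg (V p)) :=
  [set X | (forall p, extpow k (X p)) /\
    forall i, exists f : {set 'I_n} -> M -> R,
      (forall A, smooth_fun_on (chart_dom i) (f A)) /\
      forall p, chart_dom i p ->
        X p = \sum_(A : {set 'I_n} | #|A| == k) f A p *: ext_frame (e i p) A].

Definition multivector_field k := bundle_section coord_vec k.
Definition diff_form k := bundle_section coord_covec k.

End Tangent.

Section Forms.
Variables (R : realType) (n : nat) (M : smooth_manifold R n).

Definition fiber_form :=
  forall p : M, extalg (tangent p) -> extalg (tangent p) -> R.

Definition form_family := forall (k : 'I_n.+1) (p : M), extalg (dual (tangent p)).

Definition bilinear_forms : set fiber_form :=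
  [set eta |
    [/\ forall p x, scalar (eta p x),
        forall p y, scalar (eta p ^~ y),
        forall p k l m x y z,
          extpow k x -> extpow l y -> extpow m z ->
          eta p (x * y) z = eta p x (y * z)
      & forall k l X Y, multivector_field k X -> multivector_field l Y ->
          smooth_fun_on setT (fun p => eta p (X p) (Y p))]].

Definition total_forms : set form_family :=
  [set omega | forall k : 'I_n.+1, diff_form k (omega k)].

(* The last equation takes place in the degree 0 part of the exterior algebra
   of the cotangent space, i.e. the scalars. *)
Definition associated (eta : fiber_form) (omega : form_family) : Prop :=
  (forall p k l (j : 'I_n.+1) x y,
     j = (k + l)%N :> nat -> (1 <= k + l)%N -> extpow k x -> extpow l y ->
     eta p x y = ext_eval (omega j p) (x * y)) /\
  (forall p (a b : R), (eta p a%:A b%:A)%:A = (a * b) *: omega ord0 p).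

End Forms.

(* Main.v *)
(* Restricting the associativity condition to x = 1 gives
   eta(x, y) = eta(1, x /\ y), so eta is determined by the linear maps
   z |-> eta(1, z) on the exterior powers, which are k-forms because a local
   frame e_i and its dual coframe induce dual bases of the exterior powers;
   conversely omega gives eta(x, y) = sum_k omega^(k)(x /\ y). The analytic
   point is the smoothness of the coefficients p |-> eta(1, e_A(p)): the
   coordinate field e_A is only local, whereas eta is tested on global
   fields. Multiplying e_A by a bump function rho supported in the chart gives
   a global smooth field, and the coefficient is eta(1, rho e_A) / rho near the
   given point. *)
Require Import Defs.
From mathcomp Require Import all_boot all_order all_algebra.
From mathcomp Require Import perm finmap monalg.
From mathcomp Require Import all_classical all_reals all_analysis.
From mathcomp Require Import ring.

Set Implicit Arguments.
Unset Strict Implicit.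
Unset Printing Implicit Defensive.

Import Order.TTheory GRing.Theory Num.Theory.
Import numFieldNormedType.Exports.

Local Open Scope classical_set_scope.
Local Open Scope ring_scope.

(** * Calculus of C^k maps *)

Section SmoothCalculus.
Variables (R : realType) (V : normedModType R).
Implicit Types (k : nat) (U : set V).

(** The first-order expansion at x depends only on the germ of the map, so ['d f x] also satisfies
    the expansion of g, and [diff_unique] identifies it with ['d g x]. *)
Lemma near_eq_differentiable (W : normedModType R) (f g : V -> W) x :
  {near x, f =1 g} -> differentiable f x -> differentiable g x.
Proof.
move=> fg /diff_locallyP[cd /eqaddoP df].
have dg : g \o shift x = cst (g x) + 'd f x +o_ 0 id.
  apply/eqaddoP => e e0; have := df _ e0.
  have : \forall h \near (0 : V), f (h + x) = g (h + x).
    by have := fg; rewrite [X in X -> _](near_shift 0) subr0.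
  apply: filterS2 => h fgh.
  by rewrite !fctE /= fgh (nbhs_singleton fg).
by apply/diff_locallyP; rewrite (diff_unique cd dg).
Qed.

Lemma C_on_sub k (W : normedModType R) U U' (f : V -> W) :
  U' `<=` U -> C_on k U f -> C_on k U' f.
Proof.
elim: k f => [|k ih] f sU /= h; first by move=> x /sU; exact: h.
by split=> [x /sU|v]; [exact: h.1|apply: ih => //; exact: h.2].
Qed.

Lemma C_onS k (W : normedModType R) U (f : V -> W) : C_on k.+1 U f -> C_on k U f.
Proof.
elim: k f => [|k ih] f /= [df Df].
  by move=> x Ux; apply: differentiable_continuous; exact: df.
by split => // v; apply: ih; exact: Df.
Qed.

(** Every clause of [C_on] concerns single points, with derivatives taken in the ambient space, so
    regularity can be glued over a cover. *)
Lemma C_on_local k (W : normedModType R) U (f : V -> W) :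
  (forall x, U x -> exists2 U', U' x & C_on k U' f) -> C_on k U f.
Proof.
elim: k f => [|k ih] f /= h; first by move=> x /h[U' Ux]; exact.
split=> [x /h[U' Ux [df _]]|v]; first exact: df.
by apply: ih => x /h[U' Ux [_ /(_ v) Df]]; exists U'.
Qed.

(** Openness turns equality on U into equality near each of its points, so the directional
    derivatives also agree on U and the induction goes through. *)
Lemma C_on_ext k (W : normedModType R) U (f g : V -> W) :
  open U -> (forall x, U x -> f x = g x) -> C_on k U f -> C_on k U g.
Proof.
move=> oU; have nearU (h1 h2 : V -> W) x : (forall y, U y -> h1 y = h2 y) ->
    U x -> {near x, h1 =1 h2}.
  move=> h12 Ux; have : nbhs x U by exact: open_nbhs_nbhs.
  by apply: filterS => y; exact: h12.
elim: k f g => [|k ih] f g fg /=.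
  move=> h x Ux; rewrite /prop_for /continuous_at -fg //.
  apply: cvg_trans (h x Ux); apply: near_eq_cvg; exact: nearU.
move=> [df Df]; split=> [x Ux|v].
  by apply: near_eq_differentiable (df x Ux); exact: nearU.
apply: ih (Df v) => x Ux; apply: near_eq_derive; exact: nearU.
Qed.

Lemma C_on_cst k (W : normedModType R) U (a : W) : C_on k U (fun=> a : W).
Proof.
elim: k a => [|k ih] a /=; first by move=> x _; exact: cst_continuous.
split=> [x _|v]; first exact: differentiable_cst.
rewrite (_ : 'D_v _ = fun=> 0 : W); first exact: ih.
by apply/funext => x; exact: derive_cst.
Qed.

Lemma C_onD k U (f g : V -> R^o) : open U ->
  C_on k U f -> C_on k U g -> C_on k U (fun x => f x + g x : R^o).
Proof.
move=> oU; elim: k f g => [|k ih] f g /=.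
  by move=> hf hg x Ux; apply: cvgD; [exact: hf|exact: hg].
move=> [df Df] [dg Dg]; split=> [x Ux|v].
  by apply: differentiableD; [exact: df|exact: dg].
apply: C_on_ext (ih _ _ (Df v) (Dg v)) => // x Ux.
by apply/esym/deriveD; apply: diff_derivable; [exact: df|exact: dg].
Qed.

Lemma C_onM k U (f g : V -> R^o) : open U ->
  C_on k U f -> C_on k U g -> C_on k U (fun x => f x * g x : R^o).
Proof.
move=> oU; elim: k f g => [|k ih] f g; first last.
  move=> hf hg; have [[df Df] [dg Dg]] := (hf, hg); split=> [x Ux|v].
    by apply: differentiableM; [exact: df|exact: dg].
  have := C_onD oU (ih _ _ (C_onS hf) (Dg v)) (ih _ _ (C_onS hg) (Df v)).
  apply: C_on_ext => // x Ux.
  by apply/esym/deriveM; apply: diff_derivable; [exact: df|exact: dg].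
by move=> /= hf hg x Ux; apply: (cvgM (hf x Ux) (hg x Ux)).
Qed.

(** The derivative of 1/f is -f'/f^2, a product built from 1/f and f', both of class C^k by
    induction. *)
Lemma C_onV k U (f : V -> R^o) : open U -> (forall x, U x -> f x != 0) ->
  C_on k U f -> C_on k U (fun x => (f x)^-1 : R^o).
Proof.
move=> oU f0; elim: k => [|k ih].
  by move=> /= hf x Ux; apply: (cvgV (f0 x Ux) (hf x Ux)).
move=> hf; have [df Df] := hf; split=> [x Ux|v].
  by apply: differentiableV; [exact: df|exact: f0].
have Ck := ih (C_onS hf).
have := C_onM oU (C_onM oU Ck Ck) (C_onM oU (C_on_cst k U (-1 : R^o)) (Df v)).
apply: C_on_ext => // x Ux; rewrite -/(f x).
rewrite [RHS]deriveV ?f0 //; last exact/diff_derivable/df.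
by rewrite mulN1r mulrN scaleNr -expr2 exprVn.
Qed.

Lemma C_on_sum k U (I : Type) (r : seq I) (P : pred I) (f : I -> V -> R^o) :
  open U -> (forall i, P i -> C_on k U (f i)) ->
  C_on k U (fun x => \sum_(i <- r | P i) f i x : R^o).
Proof.
move=> oU hf; elim: r => [|i r ih].
  by under eq_fun do rewrite big_nil; exact: C_on_cst.
case Pi: (P i); under eq_fun do rewrite big_cons Pi; last exact: ih.
by apply: C_onD => //; exact: hf.
Qed.

Lemma C_on_prod k U (I : Type) (r : seq I) (P : pred I) (f : I -> V -> R^o) :
  open U -> (forall i, P i -> C_on k U (f i)) ->
  C_on k U (fun x => \prod_(i <- r | P i) f i x : R^o).
Proof.
move=> oU hf; elim: r => [|i r ih].
  by under eq_fun do rewrite big_nil; exact: C_on_cst.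
case Pi: (P i); under eq_fun do rewrite big_cons Pi; last exact: ih.
by apply: C_onM => //; exact: hf.
Qed.

Lemma C_on_det k U m (f : 'I_m -> 'I_m -> V -> R^o) :
  open U -> (forall i j, C_on k U (f i j)) ->
  C_on k U (fun x => \det (\matrix_(i, j) f i j x) : R^o).
Proof.
move=> oU hf; apply: (@C_on_sum k U _ _ predT
  (fun (s : 'S_m) x => (-1) ^+ s * \prod_i (\matrix_(i, j) f i j x) i (s i))) => //.
move=> s _; apply: C_onM => //; first exact: C_on_cst.
apply: C_on_ext (@C_on_prod k U _ _ predT (fun i => f i (s i)) oU _) => //.
by move=> x _; apply: eq_bigr => i _; rewrite mxE.
Qed.

Lemma differentiable_mxcoord m (f : V -> 'rV[R]_m) x b :
  differentiable f x -> differentiable (fun y => f y 0 b : R^o) x.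
Proof. by move=> df; exact: (differentiable_comp df (differentiable_coord (f x) 0 b)). Qed.

Lemma C_on_coord k U m (f : V -> 'rV[R]_m) b : open U ->
  C_on k U f -> C_on k U (fun x => f x 0 b : R^o).
Proof.
move=> oU; elim: k f => [|k ih] f /=.
  move=> hf x Ux.
  exact: (@continuous_comp _ _ _ f (fun y : 'rV[R]_m => y 0 b : R^o) x (hf x Ux)
    (@coord_continuous R 1 m 0 b (f x))).
move=> [df Df]; split=> [x Ux|v]; first exact/differentiable_mxcoord/df.
apply: C_on_ext (ih _ (Df v)) => // x Ux.
by rewrite derive_mx ?mxE //; exact/diff_derivable/df.
Qed.

End SmoothCalculus.

(** By the chain rule in coordinates, D_v(g o f) is the sum over b of (D_v f)_b times (D_b g) o f.
    The induction hypothesis applies to the partial derivatives of g, which are again scalar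
    functions. *)
Lemma C_on_comp (R : realType) (V : normedModType R) m k (U : set V)
    (U' : set 'rV[R]_m) (f : V -> 'rV[R]_m) (g : 'rV[R]_m -> R^o) :
  open U -> (forall x, U x -> U' (f x)) ->
  C_on k U f -> C_on k U' g -> C_on k U (g \o f).
Proof.
move=> oU fU; elim: k g => [|k ih] g.
  move=> /= hf hg x Ux; apply: continuous_comp; first exact: hf.
  exact/hg/fU.
move=> hf [dg Dg]; have [df Df] := hf; split=> [x Ux|v].
  by apply: differentiable_comp; [exact: df|exact/dg/fU].
have CS : C_on k U (fun x =>
    \sum_b ('D_v f x) 0 b * ('D_(delta_mx 0 b) g (f x)) : R^o).
  apply: C_on_sum => // b _; apply: C_onM => //; first exact: C_on_coord (Df v).
  exact: (ih _ (C_onS hf) (Dg _)).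
apply: C_on_ext CS => // x Ux.
have dfx := df x Ux; have dgx := dg _ (fU _ Ux).
rewrite [RHS]deriveE; last exact: differentiable_comp.
rewrite diff_comp //= -(deriveE _ dfx) [X in _ = 'd _ _ X]matrix_sum_delta.
rewrite big_ord1 linear_sum; apply: eq_bigr => b _.
by rewrite linearZ /= (deriveE _ dgx).
Qed.

(** * A smooth bump on the real line *)

Section Flat.
Variable R : realType.
Implicit Types (x : R) (m : nat).

(* The functions x^-m exp(-1/x), extended by 0 to x <= 0, are closed under
   linear combinations of derivatives; all are O(x^2) at 0. *)
Definition flat m x : R := if 0 < x then x^-1 ^+ m * expR (- x^-1) else 0.

Lemma flat_gt0 m x : 0 < x -> 0 < flat m x.
Proof. by move=> x0; rewrite /flat x0 mulr_gt0 ?exprn_gt0 ?invr_gt0 ?expR_gt0. Qed.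

Lemma flat_le0 m x : x <= 0 -> flat m x = 0.
Proof. by move=> x0; rewrite /flat ltNge x0. Qed.

Lemma flat_ge0 m x : 0 <= flat m x.
Proof. by case: (ltP 0 x) => x0; [exact/ltW/flat_gt0|rewrite flat_le0]. Qed.

(** For x > 0 a single term of the exponential series gives exp(1/x) >= x^-(m+2) / (m+2)!, and
    multiplying by x^-m leaves x^2. The second power makes the difference quotient at 0 tend to
    0. *)
Lemma flat_bound m x : flat m x <= (m.+2)`!%:R * x ^+ 2.
Proof.
case: (ltP 0 x) => x0; last by rewrite flat_le0 // mulr_ge0 ?sqr_ge0 ?ler0n.
have y0 : 0 <= x^-1 by rewrite invr_ge0 ltW.
rewrite /flat x0 expRN ler_pdivrMr ?expR_gt0 //.
have := expR_ge1Dxn m.+1 y0; set e := expR _ => he.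
have f0 : (0 : R) < (m.+2)`!%:R by rewrite ltr0n fact_gt0.
have {}he : x^-1 ^+ m.+2 <= (m.+2)`!%:R * e.
  rewrite -ler_pdivrMl // mulrC; apply: le_trans he.
  by rewrite lerDr ler01.
have -> : x^-1 ^+ m = x^-1 ^+ m.+2 * x ^+ 2.
  by rewrite -addn2 exprD -mulrA -exprMn mulVf ?gt_eqF // expr1n mulr1.
by rewrite [leRHS]mulrAC ler_pM2r ?exprn_gt0.
Qed.

Lemma is_derive_flat m x :
  is_derive x 1 (flat m : R -> R^o) (- m%:R * flat m.+1 x + flat m.+2 x).
Proof.
have [x0|x0|->] := ltgtP x 0.
- rewrite !flat_le0 ?ltW // mulr0 addr0.
  apply: (@near_eq_is_derive _ _ _ (cst (0 : R^o))).
  by apply: filterS (lt_nbhsl x0) => y y0; rewrite flat_le0 ?ltW.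
(* The new right-hand side has the shape produced by the product, power, inverse and exponential
   rules, so that they apply by unification. *)
- have -> : - m%:R * flat m.+1 x + flat m.+2 x =
      x^-1 ^+ m *: (expR (- x^-1) * - (- x ^- 2 *: 1)) +
      expR (- x^-1) *: ((m%:R * x^-1 ^+ m.-1) *: (- x ^- 2 *: 1)).
    rewrite /flat x0 /GRing.scale /= !mulr1 opprK -exprVn.
    case: m => [|m] /=; rewrite ?expr0 ?oppr0 ?mul0r ?mulr0 ?addr0 ?add0r ?mul1r.
      by rewrite mulrC.
    rewrite ![_ ^+ m.+1]exprS; set e := expR _; set u := x^-1.
    rewrite !exprS; ring.
  apply: (@near_eq_is_derive _ _ _
    (fun y : R => (y^-1 ^+ m * expR (- y^-1)) : R^o)).
    by apply: filterS (lt_nbhsr x0) => y; rewrite /flat => ->.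
  have x1 : is_derive x 1 (fun y : R => y^-1 : R^o) (- x ^- 2 *: 1).
    by apply: is_deriveV; rewrite ?gt_eqF.
  apply: is_deriveM; have := is_deriveX m x1.
  rewrite (_ : (fun y : R => y^-1 : R^o) ^+ m = fun y => y^-1 ^+ m) //.
  by apply/funext => y; rewrite exprfctE.
- rewrite !flat_le0 // mulr0 addr0.
  (* By [flat_bound] the difference quotient at 0 is at most (m+2)! |h| in absolute value. *)
  have h0 : h^-1 *: (((flat m : R -> R^o) \o shift 0) (h *: 1) - flat m 0)
      @[h --> 0^'] --> (0 : R^o).
    have C0 : (0 : R) < (m.+2)`!%:R by rewrite ltr0n fact_gt0.
    apply/cvgr0Pnorm_le => e e0; near=> h.
    have hn0 : h != 0 by near: h; exact: nbhs_dnbhs_neq.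
    rewrite flat_le0 // subr0 /= addr0 normrM normfV.
    rewrite ger0_norm ?flat_ge0 // ler_pdivrMl ?normr_gt0 //.
    rewrite [h *: 1]mulr1 (le_trans (flat_bound _ _)) //.
    rewrite -[X in _ * X]real_normK ?num_real // expr2 mulrA [leRHS]mulrC.
    rewrite ler_pM2r ?normr_gt0 // -ler_pdivlMl // mulrC.
    near: h; apply: dnbhs0_le; exact: divr_gt0.
  apply: DeriveDef; first by apply/cvg_ex; exists 0.
  exact: cvg_lim h0.
Unshelve. all: by end_near. Qed.

End Flat.

(** The induction on k is for all m at once, since differentiating [flat m] brings in [flat m.+1]
    and [flat m.+2]. *)
Lemma C_on_flat (R : realType) (V : normedModType R) k (U : set V) m
    (g : V -> R^o) : open U -> C_on k U g -> C_on k U (flat m \o g : V -> R^o).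
Proof.
move=> oU; elim: k m => [|k ih] m hg.
  move=> x Ux; apply: (continuous_comp (hg x Ux)).
  apply: differentiable_continuous; apply/derivable1_diffP.
  by case: (is_derive_flat m (g x)).
have [dg Dg] := hg.
have df y : differentiable (flat m : R^o -> R^o) y.
  by apply/derivable1_diffP; case: (is_derive_flat m y).
split=> [x Ux|v]; first by apply: differentiable_comp => //; exact: dg.
have Ck j : C_on k U (flat j \o g : V -> R^o) by apply: ih; exact: C_onS.
have := C_onM oU (Dg v)
  (C_onD oU (C_onM oU (C_on_cst k U (- m%:R : R^o)) (Ck m.+1)) (Ck m.+2)).
apply: C_on_ext => // x Ux; have dgx := dg x Ux.
rewrite [RHS]deriveE; last exact: differentiable_comp.
rewrite diff_comp //= -(deriveE _ dgx) deriv1E; last exact/derivable1_diffP.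
rewrite derive1E; congr (_ * _); apply/esym.
by case: (is_derive_flat m (g x)).
Qed.

(** * Exterior powers *)

Lemma scalar_zero (R : pzRingType) (U : lmodType R) (f : U -> R) :
  scalar f -> f 0 = 0.
Proof.
by move=> hf; have := hf (-1) 0 0; rewrite scaler0 addr0 mulN1r addNr.
Qed.

Lemma scalar_scale (R : pzRingType) (U : lmodType R) (f : U -> R) a x :
  scalar f -> f (a *: x) = a * f x.
Proof. by move=> hf; rewrite -[a *: x]addr0 hf scalar_zero ?addr0. Qed.

Lemma scalar_sumZ (R : pzRingType) (U : lmodType R) (f : U -> R) I (r : seq I)
    (P : pred I) (c : I -> R) (x : I -> U) : scalar f ->
  f (\sum_(i <- r | P i) c i *: x i) = \sum_(i <- r | P i) c i * f (x i).
Proof.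
move=> hf; elim: r => [|i r ih]; first by rewrite !big_nil scalar_zero.
by rewrite !big_cons; case: ifP => // _; rewrite hf ih.
Qed.

(** Applying [phi i] to any expansion of x picks out its i-th coefficient. *)
Lemma biorthogonal_coord (R : pzRingType) (U : lmodType R) (I : finType)
    (P : pred I) (phi : I -> U -> R) (E : I -> U) (x : U) :
  (forall i, scalar (phi i)) -> (forall i j, phi i (E j) = (i == j)%:R) ->
  (exists c, x = \sum_(i | P i) c i *: E i) ->
  x = \sum_(i | P i) phi i x *: E i.
Proof.
move=> phiL phiE [c ->]; apply: eq_bigr => i Pi; congr (_ *: _).
rewrite scalar_sumZ // (bigD1 i) //= phiE eqxx mulr1 big1 ?addr0 // => j /andP[_ ji].
by rewrite phiE eq_sym (negbTE ji) mulr0.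
Qed.

(** * Products of generators with square zero *)

Section AlternatingProducts.
Variables (R : fieldType) (V : lmodType R) (A : algType R) (g : V -> A).
Hypotheses (g_linear : linear g) (g_sqr : forall v, g v * g v = 0).
Implicit Types (x y : A) (s t : seq V).

(** Polarization of the square of g (u + v). *)
Lemma alt_anticomm (u v : V) : g u * g v = - (g v * g u).
Proof.
have genD : g (u + v) = g u + g v by rewrite -[u]scale1r g_linear !scale1r.
have := g_sqr (u + v); rewrite genD mulrDl !mulrDr !g_sqr addr0 add0r => /eqP.
by rewrite addr_eq0 => /eqP.
Qed.

Lemma alt_prod_cat (v : V) s t :
  g v * \prod_(u <- s ++ t) g u = (-1) ^+ size s * \prod_(u <- s ++ v :: t) g u.
Proof.
elim: s => [|w s ih] /=; first by rewrite big_cons mul1r.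
rewrite !big_cons mulrA alt_anticomm mulNr -mulrA ih exprS mulN1r mulNr.
by rewrite !mulrA commr_sign.
Qed.

(** Moving the factor g v of the product to the front, at the cost of a sign, creates a square. *)
Lemma alt_mul_mem (v : V) s : v \in s -> g v * \prod_(u <- s) g u = 0.
Proof.
case/splitPr => s1 s2; apply/eqP; rewrite -(signrMK (size s1) (\prod_(u <- _) _)).
by rewrite -alt_prod_cat mulrA commr_sign -mulrA (mulrA (g v)) g_sqr mul0r mulr0.
Qed.

(** Only the existence of a sign is recorded; spanning arguments do not need its value. *)
Lemma perm_alt_prod s t : perm_eq s t ->
  exists b : nat, \prod_(u <- s) g u = (-1) ^+ b * \prod_(u <- t) g u.
Proof.
elim: s t => [|v s ih] t pst.
  by move: pst; rewrite perm_sym => /perm_nilP ->; exists 0; rewrite mul1r.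
have /splitPr vt : v \in t by rewrite -(perm_mem pst) mem_head.
case: vt pst => t1 t2; rewrite perm_sym -cat1s perm_catCA /= perm_cons perm_sym.
move=> /ih[b hb]; exists (b + size t1)%N.
by rewrite big_cons hb mulrA commr_sign -mulrA alt_prod_cat mulrA -exprD.
Qed.

(** For [g := ext_gen] this is convertible to [extpow k], which is how the results below transfer to
    exterior powers. *)
Definition prod_span k : set A :=
  [set x | exists (r : nat) (c : 'I_r -> R) (v : 'I_r -> k.-tuple V),
     x = \sum_(i < r) c i *: \prod_(u <- v i) g u].

Lemma prod_span0 k : prod_span k 0.
Proof. by exists 0, (fun=> 0), (fun=> [tuple of nseq k 0]); rewrite big_ord0. Qed.

Lemma prod_spanD k x y : prod_span k x -> prod_span k y -> prod_span k (x + y).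
Proof.
move=> [r [c [v ->]]] [r' [c' [v' ->]]].
exists (r + r')%N, (fun i : 'I_(r + r') =>
  match fintype.split i with inl j => c j | inr j => c' j end).
exists (fun i : 'I_(r + r') => match fintype.split i with inl j => v j | inr j => v' j end).
rewrite big_split_ord; congr (_ + _); apply: eq_bigr => i _.
  by rewrite -[lshift _ _]/(unsplit (inl i)) unsplitK.
by rewrite -[rshift _ _]/(unsplit (inr i)) unsplitK.
Qed.

Lemma prod_spanZ k a x : prod_span k x -> prod_span k (a *: x).
Proof.
move=> [r [c [v ->]]]; exists r, (fun i => a * c i), v.
by rewrite scaler_sumr; apply: eq_bigr => i _; rewrite scalerA.
Qed.

Lemma prod_span_sum k I (r : seq I) (P : pred I) (F : I -> A) :
  (forall i, P i -> prod_span k (F i)) ->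
  prod_span k (\sum_(i <- r | P i) F i).
Proof.
by move=> h; apply: big_ind => //; [exact: prod_span0|exact: prod_spanD].
Qed.

Lemma prod_span_prod s : prod_span (size s) (\prod_(u <- s) g u).
Proof. by exists 1, (fun=> 1), (fun=> in_tuple s); rewrite big_ord1 scale1r. Qed.

Lemma prod_span_ind k (P : A -> Prop) :
  P 0 -> (forall a x y, P x -> P y -> P (a *: x + y)) ->
  (forall s, size s = k -> P (\prod_(u <- s) g u)) ->
  forall x, prod_span k x -> P x.
Proof.
move=> P0 PD Pp _ [r [c [v ->]]]; elim/big_rec: _ => // i x _.
by apply: PD; apply: Pp; rewrite size_tuple.
Qed.

Lemma prod_spanM k l x y :
  prod_span k x -> prod_span l y -> prod_span (k + l) (x * y).
Proof.
move=> hx hy; elim/prod_span_ind: hx => [||s <-].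
- by rewrite mul0r; exact: prod_span0.
- by move=> a u v hu hv; rewrite mulrDl -scalerAl; apply/prod_spanD/hv/prod_spanZ.
elim/prod_span_ind: hy => [||t <-].
- by rewrite mulr0; exact: prod_span0.
- by move=> a u v hu hv; rewrite mulrDr -scalerAr; apply/prod_spanD/hv/prod_spanZ.
by rewrite -big_cat -size_cat; exact: prod_span_prod.
Qed.

Variables (n : nat) (e : 'I_n -> V).
Implicit Types B : {set 'I_n}.

Lemma alt_frameE B : \prod_(a in B) g (e a) = \prod_(u <- map e (enum B)) g u.
Proof. by rewrite big_map -[LHS]big_filter [index_enum _]unlock. Qed.

Lemma alt_gen_frame a B : a \notin B -> exists b : nat,
  g (e a) * \prod_(c in B) g (e c) = (-1) ^+ b * \prod_(c in a |: B) g (e c).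
Proof.
move=> aB; rewrite !alt_frameE.
have [] := @perm_alt_prod (map e (a :: enum B)) (map e (enum (a |: B))).
  apply/perm_map/uniq_perm; rewrite ?enum_uniq //= ?mem_enum ?aB ?enum_uniq //.
  by move=> b; rewrite inE !mem_enum in_setU1.
by move=> b; rewrite /= big_cons => h; exists b.
Qed.

(** Induction on the length of a product of vectors: expand its first vector in e and its tail in
    frame products. Then g (e a) times the product over B is 0 if a is in B, and otherwise is, up to
    sign, the product over a |: B. *)
Lemma prod_span_frame k x :
  (forall v, exists c, v = \sum_a c a *: e a) -> prod_span k x ->
  exists c, x = \sum_(B : {set 'I_n} | #|B| == k) c B *: \prod_(a in B) g (e a).
Proof.
move=> spane; pose span l y :=
  exists c, y = \sum_(B : {set 'I_n} | #|B| == l) c B *: \prod_(a in B) g (e a).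
have span0 l : span l 0.
  by exists (fun=> 0); rewrite big1 // => B _; rewrite scale0r.
have spanD l a y z : span l y -> span l z -> span l (a *: y + z).
  move=> [c ->] [d ->]; exists (fun B => a * c B + d B).
  rewrite scaler_sumr -big_split; apply: eq_bigr => B _.
  by rewrite scalerDl scalerA.
have span_frame l B : #|B| = l -> span l (\prod_(a in B) g (e a)).
  move=> <-; exists (fun C => (C == B)%:R); rewrite [RHS](bigD1 B) //= eqxx scale1r.
  by rewrite [X in _ = _ + X]big1 ?addr0 // => C /andP[_ /negbTE ->]; rewrite scale0r.
have spanZ l a y : span l y -> span l (a *: y).
  by move=> hy; rewrite -[_ *: y]addr0; exact: spanD.
have span_sum l I (r : seq I) (P : pred I) F : (forall i, P i -> span l (F i)) ->
    span l (\sum_(i <- r | P i) F i).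
  move=> h; apply: big_rec => // i y Pi; rewrite -[F i]scale1r.
  exact/spanD/h.
elim/prod_span_ind => [||s <-]; [exact: span0|exact: spanD|].
elim: s => [|v s [c hc]].
  exists (fun=> 1); rewrite big_nil (big_pred1 finset.set0) => [|B]; last exact: cards_eq0.
  by rewrite scale1r big_set0.
have [d ->] := spane v; rewrite big_cons hc.
have gen_sum : g (\sum_a d a *: e a) = \sum_a d a *: g (e a).
  elim/big_rec2: _ => [|a y u _ <-]; last by rewrite g_linear.
  by have := g_linear (-1) 0 0; rewrite scaler0 addr0 scaleN1r addNr.
rewrite gen_sum mulr_suml; apply: (span_sum) => a _.
rewrite mulr_sumr; apply: span_sum => B /eqP cB.
rewrite -scalerAl -scalerAr; apply/spanZ/spanZ.
have [aB|aB] := boolP (a \in B).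
  by rewrite alt_frameE alt_mul_mem ?map_f ?mem_enum //; exact: span0.
have [b ->] := alt_gen_frame aB.
rewrite -signr_odd mulr_sign -scaler_sign; apply: spanZ.
by apply: span_frame; rewrite cardsU1 aB cB.
Qed.

End AlternatingProducts.

Section ExtPow.
Variables (R : fieldType) (V : lmodType R).
Implicit Types (x y : extalg V) (s t : seq V).

Lemma extpowZ k a x : extpow k x -> extpow k (a *: x).
Proof. exact: (@prod_spanZ _ _ _ (@ext_gen R V)). Qed.

Lemma extpow_sum k I (r : seq I) (P : pred I) (F : I -> extalg V) :
  (forall i, P i -> extpow k (F i)) -> extpow k (\sum_(i <- r | P i) F i).
Proof. exact: (@prod_span_sum _ _ _ (@ext_gen R V)). Qed.

Lemma extpow_prod s : extpow (size s) (\prod_(u <- s) ext_gen u).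
Proof. exact: (@prod_span_prod _ _ _ (@ext_gen R V)). Qed.

Lemma extpow1 : extpow 0 (1 : extalg V).
Proof. by have := extpow_prod [::]; rewrite big_nil. Qed.

Lemma extpow_ind k (P : extalg V -> Prop) :
  P 0 -> (forall a x y, P x -> P y -> P (a *: x + y)) ->
  (forall s, size s = k -> P (\prod_(u <- s) ext_gen u)) ->
  forall x, extpow k x -> P x.
Proof. exact: (@prod_span_ind _ _ _ (@ext_gen R V)). Qed.

Lemma extpowM k l x y : extpow k x -> extpow l y -> extpow (k + l) (x * y).
Proof. exact: (@prod_spanM _ _ _ (@ext_gen R V)). Qed.

(** Every element comes from the free algebra, whose monomials are words. This reduces identities
    between bilinear maps on the whole exterior algebra to products of vectors, which are
    homogeneous. *)
Lemma extalg_ind (P : extalg V -> Prop) :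
  P 0 -> (forall a x y, P x -> P y -> P (a *: x + y)) ->
  (forall s, P (\prod_(u <- s) ext_gen u)) -> forall x, P x.
Proof.
move=> P0 PD Pp; elim/ext_pi_ind => x.
rewrite (monalgE x) (big_morph _ (@ext_piD R V) (raddf0 _)).
elim/big_rec: _ => // a y _ Py.
have -> : << x@_a *g a >> = x@_a *: << a >> :> {malg R[{fmonom V}]}.
  by apply/malgP => b; rewrite mcoeffZ !mcoeffU mulr_natr.
rewrite -ext_pi_scale; apply: PD => //.
have := Pp (fmonom_val a); rewrite ext_prod_gen; congr (P (ext_pi << _ >>)).
exact: val_inj.
Qed.

End ExtPow.

Lemma ext_frame_prod (R : realType) n (V : lmodType R) (e : 'I_n -> V)
    (A : {set 'I_n}) :
  ext_frame e A = \prod_(u <- map e (enum A)) ext_gen u.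
Proof. exact: alt_frameE. Qed.

Lemma ext_frame_extpow (R : realType) n (V : lmodType R) (e : 'I_n -> V)
    (A : {set 'I_n}) :
  extpow #|A| (ext_frame e A).
Proof. by rewrite ext_frame_prod cardE -(size_map e); exact: extpow_prod. Qed.

Lemma extpow_frame (R : realType) n (V : lmodType R) (e : 'I_n -> V) k
    (x : extalg V) :
  (forall v, exists c, v = \sum_a c a *: e a) -> extpow k x ->
  exists c, x = \sum_(A : {set 'I_n} | #|A| == k) c A *: ext_frame e A.
Proof.
exact: (prod_span_frame (@ext_gen_linear R V) (@ext_gen_sqr R V)).
Qed.

(** The spanning family is indexed by the k-element subsets of ['I_n], and there are none. *)
Lemma extpow_gt (R : realType) n (V : lmodType R) (e : 'I_n -> V) k (x : extalg V) :
  (forall v, exists c, v = \sum_a c a *: e a) -> (n < k)%N -> extpow k x -> x = 0.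
Proof.
move=> spane nk /(extpow_frame spane)[c ->]; rewrite big_pred0 // => A.
by apply/negbTE; rewrite neq_ltn (leq_ltn_trans _ nk) // -[n in leqRHS]card_ord max_card.
Qed.

(** * Bilinearity and grading of the evaluation of forms *)

Section ExtEval.
Variables (R : realType) (V : lmodType R).
Implicit Types (w : extalg (dual V)) (x y : extalg V).

Lemma ext_eval_scalarr w : scalar (ext_eval w).
Proof.
move=> a; elim/ext_pi_ind: w => w; elim/ext_pi_ind => x; elim/ext_pi_ind => y.
have -> : a *: ext_pi x + ext_pi y = ext_pi (a *: x + y).
  by rewrite ext_piD -ext_pi_scale.
by rewrite !ext_eval_pi !free_pairingEr linearP.
Qed.

Lemma ext_eval_scalarl x : scalar (fun w => ext_eval w x).
Proof.
move=> a; elim/ext_pi_ind: x => x; elim/ext_pi_ind => w; elim/ext_pi_ind => w'.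
have -> : a *: ext_pi w + ext_pi w' = ext_pi (a *: w + w').
  by rewrite ext_piD -ext_pi_scale.
by rewrite !ext_eval_pi !free_pairingE linearP.
Qed.

Lemma ext_eval0r w : ext_eval w 0 = 0.
Proof. exact/scalar_zero/ext_eval_scalarr. Qed.

Lemma ext_eval0l x : ext_eval 0 x = 0.
Proof. exact: (scalar_zero (ext_eval_scalarl x)). Qed.

Lemma ext_eval_prod (s : seq (dual V)) (t : seq V) :
  ext_eval (\prod_(f <- s) ext_gen f) (\prod_(u <- t) ext_gen u) = word_pairing s t.
Proof. by rewrite !ext_prod_gen ext_eval_pi free_pairingE !word_liftU !mul1r. Qed.

Lemma ext_eval_deg k l w x : k != l -> extpow k w -> extpow l x -> ext_eval w x = 0.
Proof.
move=> kl hw hx; elim/extpow_ind: hw => [|a u v hu hv|s sk].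
- exact: ext_eval0l.
- by rewrite ext_eval_scalarl hu hv mulr0 addr0.
elim/extpow_ind: hx => [|a u v hu hv|t tl].
- exact: ext_eval0r.
- by rewrite ext_eval_scalarr hu hv mulr0 addr0.
by rewrite ext_eval_prod /word_pairing sk tl (negbTE kl).
Qed.

End ExtEval.

(* [onth] rather than [nth]: 'I_n may have no element to serve as default. *)
Definition kronecker_pairing (R : realType) n (s t : seq 'I_n) : R :=
  if size s == size t then
    \det (\matrix_(i < size s, j < size s) (onth s i == onth t j)%:R) else 0.

(** * Dual bases of the exterior powers *)

Section DualBases.
Variables (R : realType) (n : nat) (V : lmodType R).
Variables (e : 'I_n -> V) (eps : 'I_n -> dual V).
Implicit Types A B : {set 'I_n}.
Hypothesis eps_e : forall a b, (eps a : dual V) (e b) = (a == b)%:R.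
Hypothesis e_span : forall v, v = \sum_a (eps a : dual V) v *: e a.

Lemma word_pairing_dual (s t : seq 'I_n) :
  word_pairing (map eps s) (map e t) = kronecker_pairing R s t.
Proof.
rewrite /word_pairing /kronecker_pairing !size_map; case: eqP => // st.
congr (\det _); apply/matrixP => i j; rewrite !mxE.
have it : (j < size t)%N by rewrite -st.
(* A row index [i] exists, so [s] is nonempty and its head can serve as the default element. *)
have [x0 _] : exists x0 : 'I_n, true by case: s i j {st it} => [[]|a *] //; exists a.
rewrite (nth_map x0) // (nth_map x0) // eps_e !onthE.
by rewrite !(nth_map x0) //.
Qed.

(** These are the structure constants of the wedge product in the frame. The right-hand side
    involves neither e nor eps, so over a chart it is constant in the point. *)
Lemma ext_eval_frameM A B C :
  ext_eval (ext_frame eps C) (ext_frame e A * ext_frame e B) =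
  kronecker_pairing R (enum C) (enum A ++ enum B).
Proof.
by rewrite !ext_frame_prod -big_cat -map_cat ext_eval_prod word_pairing_dual.
Qed.

(** For A = B the matrix is the identity, as enumerations have no repetition. For distinct A and B
    of the same size, an element of A outside B gives a zero row; different sizes pair to 0 by
    definition. *)
Lemma ext_eval_frame A B :
  ext_eval (ext_frame eps A) (ext_frame e B) = (A == B)%:R.
Proof.
rewrite !ext_frame_prod ext_eval_prod word_pairing_dual /kronecker_pairing -!cardE.
case: (eqVneq A B) => [->|AB].
  rewrite eqxx -[RHS](@det1 R #|B|) cardE; congr (\det _).
  apply/matrixP => i j; rewrite !mxE !onthE nth_uniq ?size_map //.
  by rewrite map_inj_uniq ?enum_uniq // => a b [].
case: eqP => // cAB.
have /subsetPn[a aA aB] : ~~ (A \subset B).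
  by apply: contra AB => sAB; rewrite eqEcard sAB cAB leqnn.
have ia : (index a (enum A) < #|A|)%N by rewrite cardE index_mem mem_enum.
rewrite (expand_det_row _ (Ordinal ia)) big1 // => j _.
have jB : (j < size (enum B))%N by rewrite -cardE -cAB.
have iA : (index a (enum A) < size (enum A))%N by rewrite index_mem mem_enum.
rewrite mxE !onthE /= !(nth_map a) // nth_index ?mem_enum //.
case: eqP => [[ab]|_]; last by rewrite mul0r.
by have := mem_nth a jB; rewrite -ab mem_enum (negbTE aB).
Qed.

Lemma dual_span (f : dual V) : f = \sum_a (f : dual V) (e a) *: eps a.
Proof.
apply: val_inj; apply/funext => v; rewrite [in LHS](e_span v).
rewrite scalar_sumZ; last exact: dual_scalar.
have dualE c (g h : dual V) : dual_fun (c *: g + h) v = c * g v + h v by [].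
rewrite /=; elim/big_rec2: _ => // a y g _ ->.
by rewrite dualE mulrC.
Qed.

Lemma ext_frame_coord k x : extpow k x ->
  x = \sum_(A : {set 'I_n} | #|A| == k) ext_eval (ext_frame eps A) x *: ext_frame e A.
Proof.
have spane v : exists c, v = \sum_a c a *: e a.
  by exists (fun a => (eps a : dual V) v); exact: e_span.
move=> /(extpow_frame spane).
apply: (biorthogonal_coord (phi := fun A => ext_eval (ext_frame eps A))) => [A|A B].
  exact: ext_eval_scalarr.
exact: ext_eval_frame.
Qed.

Lemma ext_coframe_coord k w : extpow k w ->
  w = \sum_(A : {set 'I_n} | #|A| == k) ext_eval w (ext_frame e A) *: ext_frame eps A.
Proof.
have spane v : exists c, v = \sum_a c a *: eps a.
  by exists (fun a => (v : dual V) (e a)); exact: dual_span.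
move=> /(extpow_frame spane).
apply: (biorthogonal_coord (phi := fun A w => ext_eval w (ext_frame e A))) => [A|A B].
  exact: (ext_eval_scalarl (ext_frame e A)).
by rewrite ext_eval_frame eq_sym.
Qed.

End DualBases.

(** * Smooth functions and coordinate frames on a manifold *)

Section SmoothFunctions.
Variables (R : realType) (n : nat) (M : smooth_manifold R n).
Implicit Types (i j : mfd_idx M) (p : M) (A W : set M) (f g : M -> R).

(** Near a point of the image, this set is the preimage of W and the chart domain under
    [chart_inv i]. Continuity of that map is only known on the chart image, hence the argument by
    neighbourhoods. *)
Lemma open_chart_img i W : open W -> open (chart i @` (W `&` chart_dom i)).
Proof.
move=> oW; rewrite openE => _ [p [Wp ip] <-].
have cip : (chart i @` chart_dom i) (chart i p) by exists p.
have ci : {for chart i p, continuous (chart_inv i)}.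
  by apply: chart_inv_continuous; rewrite inE.
have : nbhs (chart i p) (chart_inv i @^-1` (W `&` chart_dom i)).
  apply: ci; rewrite chartK ?inE //; apply: open_nbhs_nbhs; split=> //.
  by apply: openI => //; exact: chart_dom_open.
have : nbhs (chart i p) (chart i @` chart_dom i).
  apply: open_nbhs_nbhs; split=> //; exact: chart_img_open.
rewrite /interior; apply: filterS2 => y [q iq <-]; rewrite /= chartK ?inE // => Wq.
by exists q.
Qed.

Lemma smooth_fun_sub A W f : W `<=` A -> smooth_fun_on A f -> smooth_fun_on W f.
Proof.
move=> WA sf i k; apply: C_on_sub (sf i k).
by move=> _ [p [/WA Ap ip] <-]; exists p.
Qed.

Lemma smooth_fun_local A f :
  (forall p, A p -> exists2 W, W p & smooth_fun_on W f) -> smooth_fun_on A f.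
Proof.
move=> h i k; apply: C_on_local => _ [p [Ap ip] <-].
have [W Wp sf] := h p Ap; exists (chart i @` (W `&` chart_dom i)) => //.
  by exists p.
exact: sf.
Qed.

Lemma smooth_fun_ext W f g : open W -> (forall p, W p -> f p = g p) ->
  smooth_fun_on W f -> smooth_fun_on W g.
Proof.
move=> oW fg sf i k; apply: C_on_ext (sf i k); first exact: open_chart_img.
by move=> _ [p [Wp ip] <-]; rewrite /= chartK ?inE // fg.
Qed.

Lemma smooth_fun_cst A (a : R) : smooth_fun_on A (fun=> a).
Proof. by move=> i k; exact: C_on_cst. Qed.

Lemma smooth_funM W f g : open W -> smooth_fun_on W f -> smooth_fun_on W g ->
  smooth_fun_on W (fun p => f p * g p).
Proof.
by move=> oW sf sg i k; apply: C_onM; [exact: open_chart_img|exact: sf|exact: sg].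
Qed.

Lemma smooth_funV W f : open W -> (forall p, W p -> f p != 0) ->
  smooth_fun_on W f -> smooth_fun_on W (fun p => (f p)^-1).
Proof.
move=> oW f0 sf i k; apply: C_onV; [exact: open_chart_img| |exact: sf].
by move=> _ [p [Wp ip] <-]; rewrite /= chartK ?inE // f0.
Qed.

Lemma smooth_fun_sum W I (r : seq I) (P : pred I) (F : I -> M -> R) : open W ->
  (forall a, P a -> smooth_fun_on W (F a)) ->
  smooth_fun_on W (fun p => \sum_(a <- r | P a) F a p).
Proof.
move=> oW sF i k; apply: C_on_sum => [|a Pa]; first exact: open_chart_img.
exact: sF.
Qed.

Lemma smooth_fun_det W m (F : 'I_m -> 'I_m -> M -> R) : open W ->
  (forall a b, smooth_fun_on W (F a b)) ->
  smooth_fun_on W (fun p => \det (\matrix_(a, b) F a b p)).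
Proof.
move=> oW sF i k; apply: C_on_det => [|a b]; first exact: open_chart_img.
exact: sF.
Qed.

(** Read in a chart i, the function is g after the change of coordinates from i to j, which is
    smooth by the atlas condition. *)
Lemma smooth_fun_chart W j (g : 'rV[R]_n -> R) : open W -> W `<=` chart_dom j ->
  smooth_on (chart j @` W) (g : _ -> R^o) -> smooth_fun_on W (g \o chart j).
Proof.
move=> oW Wj sg i k.
apply: (@C_on_comp _ _ _ k _ _ (chart j \o chart_inv i) _ _ _ _ (sg k)).
- exact: open_chart_img.
- by move=> _ [p [Wp ip] <-]; rewrite /= chartK ?inE //; exists p.
apply: C_on_sub (chart_smooth i j k) => _ [p [Wp ip] <-]; exists p => //.
by split=> //; exact: Wj.
Qed.

End SmoothFunctions.

(** * Coordinate frames and their change from chart to chart *)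

Section CoordinateFrames.
Variables (R : realType) (n : nat) (M : smooth_manifold R n).
Implicit Types (i j : mfd_idx M) (p : M).

(** The chart image is open, so the composite differentiated here is the identity near the point. *)
Lemma transition_id i p v : chart_dom i p -> transition i i p v = v.
Proof.
move=> ip.
have df : differentiable (chart i \o chart_inv i) (chart i p).
  by have [+ _] := chart_smooth (s := M) i i 1; apply; exists p.
rewrite /transition -deriveE // -[RHS](derive_id (chart i p) v).
apply: near_eq_derive.
have oi := @chart_img_open R n M i.
have : nbhs (chart i p) (chart i @` chart_dom i).
  by apply: open_nbhs_nbhs; split=> //; exists p.
by apply: filterS => y [q iq <-]; rewrite /= chartK ?inE.
Qed.

(** The pairing is an entry of the Jacobian matrix, put as a directional derivative because [C_on]
    controls those. *)
Lemma coord_covec_vec i j p a b : chart_dom i p -> chart_dom j p ->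
  (coord_covec i p b : dual _) (coord_vec j p a) =
  ('D_(delta_mx 0 a) (chart i \o chart_inv j) (chart j p)) 0 b.
Proof.
move=> ip jp; rewrite /= /coord_vec_fun asboolT // /transition deriveE //.
by have [+ _] := chart_smooth (s := M) j i 1; apply; exists p.
Qed.

Lemma coord_covec_dual i p a b : chart_dom i p ->
  (coord_covec i p a : dual _) (coord_vec i p b) = (a == b)%:R.
Proof.
move=> ip; rewrite /= /coord_vec_fun asboolT // transition_id // mxE eqxx /=.
by rewrite eq_sym.
Qed.

(** A tangent vector is determined by its component in the chart i: the transition maps give the
    components in the other charts around p, and the remaining ones are 0 on both sides. *)
Lemma tangent_coord i p (v : tangent p) : chart_dom i p ->
  v = \sum_a (coord_covec i p a : dual _) v *: coord_vec i p a.
Proof.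
move=> ip; apply: val_inj; apply/funext => j.
have [v0 vT] : (forall i, ~ chart_dom i p -> v i = 0) /\
      (forall i j, chart_dom i p -> chart_dom j p ->
         v j = transition i j p (v i)) by exact/asboolP/(valP v).
have -> : \val (\sum_a (coord_covec i p a : dual _) v *: coord_vec i p a) j =
    \sum_a v i 0 a *: coord_vec_fun i p a j.
  by elim/big_rec2: _ => // a y w _ <-.
have [jp|nj] := pselect (chart_dom j p); last first.
  rewrite [LHS](v0 j) // big1 // => a _; rewrite /coord_vec_fun asboolF ?scaler0 //.
  by case.
rewrite /= (vT i j) // [X in transition i j p X]matrix_sum_delta big_ord1 linear_sum.
apply: eq_bigr => a _; rewrite linearZ /coord_vec_fun asboolT //.
Qed.

(** The index maps s and t are chosen before the space and the frames, so the same ones serve at all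
    points of a chart. *)
Lemma ext_eval_frame_det k (A B : {set 'I_n}) : #|A| = k -> #|B| = k ->
  exists s t : 'I_k -> 'I_n, forall (V : lmodType R) (eps : 'I_n -> dual V) e,
    ext_eval (ext_frame eps A) (ext_frame e B) =
    \det (\matrix_(a, b) (eps (s a) : dual V) (e (t b))).
Proof.
move=> kA kB.
have sA : size (enum A) == k by rewrite -cardE kA.
have sB : size (enum B) == k by rewrite -cardE kB.
exists (tnth (Tuple sA)), (tnth (Tuple sB)) => V eps e; rewrite !ext_frame_prod.
have := ext_eval_det (map_tuple eps (Tuple sA)) (map_tuple e (Tuple sB)).
move=> /= ->; congr (\det _); apply/matrixP => a b; rewrite !mxE !tnth_map.
by [].
Qed.

(** These functions are minors of the Jacobian matrix of the change of coordinates, hence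
    polynomials in smooth functions. *)
Lemma frame_change_smooth k i j (A B : {set 'I_n}) : #|A| = k -> #|B| = k ->
  smooth_fun_on (chart_dom i `&` chart_dom j) (fun p : M =>
    ext_eval (ext_frame (coord_covec i p) A) (ext_frame (coord_vec j p) B)).
Proof.
move=> kA kB; have [s [t st]] := ext_eval_frame_det kA kB.
have oW : open (chart_dom i `&` chart_dom j).
  by apply: openI; exact: chart_dom_open.
pose J a b y := ('D_(delta_mx 0 (t b)) (chart i \o chart_inv j) y) 0 (s a).
apply: (@smooth_fun_ext _ _ _ _
  (fun p => \det (\matrix_(a, b) (J a b \o chart j) p))) => //.
  move=> p [ip jp]; rewrite st; congr (\det _); apply/matrixP => a b.
  by rewrite !mxE coord_covec_vec.
apply: smooth_fun_det => // a b; apply: smooth_fun_chart => //.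
move=> l; have oU : open (chart j @` (chart_dom j `&` chart_dom i)).
  by rewrite setIC; apply: open_chart_img; exact: chart_dom_open.
rewrite setIC; apply: C_on_coord => //.
(* One extra order of regularity is spent: the Jacobian entries are C^l because the change of
   coordinates is C^(l+1). *)
by have [_] := chart_smooth (s := M) j i l.+1; apply.
Qed.

End CoordinateFrames.

(** * Extending local frames by bump functions *)

(** The bump is exp(-1/d), extended by 0, with d = r^2 minus the squared Euclidean distance to x0, a
    polynomial. The norm on row vectors is the sup norm, bounded by the Euclidean one, so the bump
    vanishes outside the sup-norm ball. *)
Lemma rV_bump (R : realType) n (x0 : 'rV[R]_n) (r : R) : 0 < r ->
  exists b : 'rV[R]_n -> R, [/\ smooth_on setT (b : _ -> R^o), 0 < b x0
    & forall y, b y != 0 -> closed_ball x0 r y].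
Proof.
move=> r0.
pose d (y : 'rV[R]_n) := r ^+ 2 - \sum_a (y 0 a - x0 0 a) ^+ 2.
exists (fun y => flat 0 (d y)); split.
- move=> k; apply: (C_on_flat (U := setT)); first exact: openT.
  have oT := @openT 'rV[R]_n.
  apply: (C_onD oT (C_on_cst k setT (r ^+ 2 : R^o)) (g := fun y => - _)).
  apply: (@C_on_ext _ _ k _ _ (fun y : 'rV[R]_n => -1 *
    \sum_a ((y 0 a + - x0 0 a) * (y 0 a + - x0 0 a)) : R^o)) => //.
    by move=> y _; rewrite mulN1r; under eq_bigr do rewrite -expr2.
  apply: C_onM => //; first exact: C_on_cst.
  apply: C_on_sum => // a _.
  have Ca : C_on k setT (fun y : 'rV[R]_n => y 0 a + - x0 0 a : R^o).
    apply: C_onD => //; last exact: C_on_cst.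
    apply: C_on_coord => //; case: k => [|k]; first by move=> y _; exact: cvg_id.
    split=> [y _|v]; first exact: ex_diff.
    rewrite (_ : 'D_v _ = fun=> v); first exact: C_on_cst.
    by apply/funext => y; exact: derive_id.
  exact: C_onM.
- apply: flat_gt0; rewrite /d big1 ?subr0 ?exprn_gt0 // => a _.
  by rewrite subrr expr0n.
move=> y by0; rewrite closed_ballE // /closed_ball_ /=.
have dy : 0 < d y by rewrite ltNge; apply: contra by0 => /(flat_le0 0) ->.
rewrite [leLHS]/Num.Def.normr /= mx_normrE; apply: bigmax_le; first exact: ltW.
move=> [a b] _; rewrite !mxE /= (ord1 a) distrC -ler_sqr ?nnegrE ?(ltW r0) //.
rewrite real_normK ?num_real //; move: dy; rewrite subr_gt0 => /ltW; apply: le_trans.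
by rewrite (bigD1 b) //= lerDl sumr_ge0 // => c _; exact: sqr_ge0.
Qed.

Section Bump.
Variables (R : realType) (n : nat) (M : smooth_manifold R n).
Implicit Types (i j : mfd_idx M) (p : M).

(** A bump on a closed ball inside the chart image is carried to M and extended by 0. The set K, the
    image of this ball under [chart_inv j], is compact, hence closed because M is Hausdorff; this
    makes the extension smooth. *)
Lemma mfd_bump j p0 : chart_dom j p0 -> exists (rho : M -> R) (K W : set M),
  [/\ smooth_fun_on setT rho, closed K /\ K `<=` chart_dom j,
      forall p, ~ K p -> rho p = 0, open W /\ W p0 & forall p, W p -> rho p != 0].
Proof.
move=> jp0; pose U := chart j @` chart_dom j.
have oU : open U by exact: chart_img_open.
have [r rU] : exists r : {posnum R}, closed_ball (chart j p0) r%:num `<=` U.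
  by apply/nbhs_closedballP/open_nbhs_nbhs; split => //; exists p0.
have [b [sb b0 bB]] := rV_bump (chart j p0) (gt0 r).
set B := closed_ball _ _ in rU bB.
pose K := chart_inv j @` B.
have cK : closed K.
  apply: compact_closed; first exact: mfd_hausdorff.
  apply: continuous_compact.
    apply: continuous_in_subspaceT => y; rewrite inE => By.
    by apply: chart_inv_continuous; rewrite inE; exact: rU.
  apply: bounded_closed_compact; last exact: closed_closure.
  exists (`|chart j p0| + r%:num); split; first exact: num_real.
  move=> m rm y; rewrite /B closed_ballE // /closed_ball_ /= => By.
  rewrite (le_trans _ (ltW rm)) // -[y](subKr (chart j p0)).
  by rewrite (le_trans (ler_normB _ _)) // lerD2l.
have Kj : K `<=` chart_dom j.
  by move=> _ [y /rU[q jq <-] <-]; rewrite chartK ?inE.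
pose rho p := if `[< chart_dom j p >] then b (chart j p) else 0.
have rhoj p : chart_dom j p -> rho p = b (chart j p).
  by move=> jp; rewrite /rho asboolT.
have rhoK p : ~ K p -> rho p = 0.
  move=> nK; rewrite /rho; case: asboolP => // jp; apply/eqP/negPn/negP => /bB By.
  by apply: nK; exists (chart j p) => //; rewrite chartK ?inE.
have oj : open (chart_dom j) by exact: chart_dom_open.
have : \forall p \near p0, 0 < b (chart j p).
  have cb : {for chart j p0, continuous (b : 'rV[R]_n -> R^o)} by exact: (sb 0).
  have cj : {for p0, continuous (chart j)}.
    by apply: chart_continuous; rewrite inE.
  have := @continuous_comp _ _ _ _ _ p0 cj cb.
  by move=> /cvgr_gt; apply.
rewrite -[X in X -> _]/(nbhs p0 _) nbhsE => -[W' [oW' Wp0] W'b].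
exists rho, K, (W' `&` chart_dom j); split => //; last 2 first.
- by split; [exact: openI|split].
- by move=> p [/W'b /= bp jp]; rewrite rhoj // gt_eqF.
apply: smooth_fun_local => p _; have [jp|nj] := pselect (chart_dom j p).
  exists (chart_dom j) => //; apply: (@smooth_fun_ext _ _ _ _ (b \o chart j)) => //.
    by move=> q jq; rewrite rhoj.
  by apply: smooth_fun_chart => // k; apply: C_on_sub (sb k).
(* A point outside the chart domain lies in the open complement of K, where rho is identically 0. *)
exists (~` K); first by move=> /Kj.
apply: (@smooth_fun_ext _ _ _ _ (fun=> 0)); first exact: closed_openC.
  by move=> q /rhoK.
exact: smooth_fun_cst.
Qed.

Lemma bump_frame_field k j (rho : M -> R) (K : set M) (A : {set 'I_n}) :
  smooth_fun_on setT rho -> closed K -> K `<=` chart_dom j ->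
  (forall p, ~ K p -> rho p = 0) -> #|A| = k ->
  multivector_field k (fun p => rho p *: ext_frame (coord_vec j p) A).
Proof.
move=> srho cK Kj rhoK kA; split=> [p|i].
  by rewrite -kA; apply/extpowZ/ext_frame_extpow.
have oi : open (chart_dom i) by exact: chart_dom_open.
(* In the chart i the coefficients are rho times Jacobian minors. Smoothness is required for every B
   while minors exist only for #|B| = k; the value 0 fills the indices that do not enter the sum. *)
exists (fun (B : {set 'I_n}) p => if #|B| == k then rho p *
  ext_eval (ext_frame (coord_covec i p) B) (ext_frame (coord_vec j p) A) else 0).
split=> [B|p ip].
  case: eqP => kB; last exact: smooth_fun_cst.
  apply: smooth_fun_local => p ip; have [jp|nj] := pselect (chart_dom j p).
    exists (chart_dom i `&` chart_dom j) => //; apply: smooth_funM.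
    - by apply: openI => //; exact: chart_dom_open.
    - exact: smooth_fun_sub srho.
    - exact: frame_change_smooth kB kA.
  exists (chart_dom i `&` ~` K); first by split=> // /Kj.
  apply: (@smooth_fun_ext _ _ _ _ (fun=> 0)); last exact: smooth_fun_cst.
    by apply: openI => //; exact: closed_openC.
  by move=> q [_ /rhoK ->]; rewrite mul0r.
have Ak : extpow k (ext_frame (coord_vec j p) A).
  by rewrite -kA; exact: ext_frame_extpow.
rewrite [X in _ *: X](ext_frame_coord (e := coord_vec i p) (eps := coord_covec i p) _ _ Ak).
- by rewrite scaler_sumr; apply: eq_bigr => B ->; rewrite scalerA.
- by move=> a b; exact: coord_covec_dual.
- by move=> v; exact: tangent_coord.
Qed.

Lemma multivector_field1 : multivector_field 0 (fun p => 1 : extalg (tangent p)).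
Proof.
split=> [p|i]; first exact: extpow1.
exists (fun _ _ => 1); split=> [A|p ip]; first exact: smooth_fun_cst.
rewrite (big_pred1 finset.set0) => [|A]; last exact: cards_eq0.
by rewrite scale1r /ext_frame big_set0.
Qed.

Lemma bilinear_forms_frame_smooth eta j (A : {set 'I_n}) : bilinear_forms eta ->
  smooth_fun_on (chart_dom j)
    (fun p : M => eta p 1 (ext_frame (coord_vec j p) A)).
Proof.
move=> [etar etal etaA etaS]; apply: smooth_fun_local => p0 jp0.
have [rho [K [W [srho [cK Kj] rhoK [oW Wp0] rhoW]]]] := mfd_bump jp0.
exists W => //.
have sX := bump_frame_field srho cK Kj rhoK (erefl #|A|).
have := etaS _ _ _ _ multivector_field1 sX.
set h := (fun p => eta p 1 (rho p *: _)) => sh.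
apply: (@smooth_fun_ext _ _ _ _ (fun p => h p * (rho p)^-1)) => //.
  move=> p /rhoW rp.
  by rewrite /h (scalar_scale _ _ (etar p 1)) mulrAC mulfV // mul1r.
apply: smooth_funM => //; first exact: smooth_fun_sub sh.
by apply: smooth_funV => //; exact: smooth_fun_sub srho.
Qed.

End Bump.

(** * The correspondence *)

Section Correspondence.
Variables (R : realType) (n : nat) (M : smooth_manifold R n).
Implicit Types (i j : mfd_idx M) (p : M) (eta : fiber_form M) (omega : form_family M).

Definition chart_at p : mfd_idx M := sval (cid (chart_cover p)).

Lemma chart_atP p : chart_dom (chart_at p) p.
Proof. by rewrite /chart_at; case: cid. Qed.

Lemma tangent_ext_coord i p k (x : extalg (tangent p)) : chart_dom i p -> extpow k x ->
  x = \sum_(A : {set 'I_n} | #|A| == k)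
    ext_eval (ext_frame (coord_covec i p) A) x *: ext_frame (coord_vec i p) A.
Proof.
move=> ip; apply: ext_frame_coord => [a b|v]; last exact: tangent_coord.
exact: coord_covec_dual.
Qed.

Lemma cotangent_ext_coord i p k (w : extalg (dual (tangent p))) :
  chart_dom i p -> extpow k w ->
  w = \sum_(A : {set 'I_n} | #|A| == k)
    ext_eval w (ext_frame (coord_vec i p) A) *: ext_frame (coord_covec i p) A.
Proof.
move=> ip; apply: ext_coframe_coord => [a b|v]; last exact: tangent_coord.
exact: coord_covec_dual.
Qed.

(** The coefficients of a k-covector in a coordinate coframe are its values on the dual frame of
    k-vectors. *)
Lemma ext_eval_inj p k (w w' : extalg (dual (tangent p))) :
  extpow k w -> extpow k w' ->
  (forall x, extpow k x -> ext_eval w x = ext_eval w' x) -> w = w'.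
Proof.
move=> hw hw' ww'; have ip := chart_atP p.
rewrite (cotangent_ext_coord ip hw) (cotangent_ext_coord ip hw').
apply: eq_bigr => A /eqP kA; rewrite ww' // -kA; exact: ext_frame_extpow.
Qed.

Lemma tangent_extpow_gt p k (x : extalg (tangent p)) :
  (n < k)%N -> extpow k x -> x = 0.
Proof.
apply: (@extpow_gt _ _ _ (coord_vec (chart_at p) p)) => v.
exists (fun a => (coord_covec (chart_at p) p a : dual _) v).
exact/tangent_coord/chart_atP.
Qed.

(** The chart used varies arbitrarily with p; by [forms_of_eval] the values on k-vectors do not
    depend on this choice when eta is in [bilinear_forms]. *)
Definition forms_of eta : form_family M := fun k p =>
  \sum_(A : {set 'I_n} | #|A| == k) eta p 1 (ext_frame (coord_vec (chart_at p) p) A)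
     *: ext_frame (coord_covec (chart_at p) p) A.

Lemma forms_of_extpow eta (k : 'I_n.+1) p : extpow k (forms_of eta k p).
Proof.
apply: extpow_sum => A /eqP <-; exact/extpowZ/ext_frame_extpow.
Qed.

Lemma forms_of_eval eta (k : 'I_n.+1) p x : bilinear_forms eta -> extpow k x ->
  ext_eval (forms_of eta k p) x = eta p 1 x.
Proof.
move=> [etar _ _ _] /(tangent_ext_coord (chart_atP p)) ->.
rewrite (scalar_sumZ _ _ _ _ (ext_eval_scalarr _)) (scalar_sumZ _ _ _ _ (etar p 1)).
apply: eq_bigr => A kA; congr (_ * _).
rewrite (scalar_sumZ _ _ _ _ (ext_eval_scalarl _)) (bigD1 A) //=.
have fr B C : ext_eval (ext_frame (coord_covec (chart_at p) p) B)
    (ext_frame (coord_vec (chart_at p) p) C) = (B == C)%:R.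
  by apply: ext_eval_frame => a b; exact/coord_covec_dual/chart_atP.
rewrite fr eqxx mulr1 big1 ?addr0 // => B /andP[_ BA].
by rewrite fr (negbTE BA) mulr0.
Qed.

Lemma forms_of_total eta : bilinear_forms eta -> total_forms (forms_of eta).
Proof.
move=> heta k; split=> [p|i]; first exact: forms_of_extpow.
(* The form is expanded again in the coframe of the fixed chart i, so that its coefficients are
   values of eta on a single coordinate frame. *)
exists (fun A p => eta p 1 (ext_frame (coord_vec i p) A)); split=> [A|p ip].
  exact: bilinear_forms_frame_smooth.
rewrite [LHS](cotangent_ext_coord ip (forms_of_extpow eta k p)).
apply: eq_bigr => A /eqP kA; rewrite forms_of_eval // -kA.
exact: ext_frame_extpow.
Qed.

Lemma bilinear_forms_mul eta p k l x y : bilinear_forms eta ->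
  extpow k x -> extpow l y -> eta p x y = eta p 1 (x * y).
Proof.
move=> [_ _ etaA _] hx hy.
by rewrite -(etaA p 0 k l) ?mul1r //; exact: extpow1.
Qed.

Lemma bilinear_forms0 eta p x : bilinear_forms eta -> eta p x 0 = 0.
Proof. by move=> [etar _ _ _]; exact: scalar_zero (etar p x). Qed.

(** Associativity is only assumed on homogeneous elements, so both arguments are first reduced to
    products of vectors. Their wedge either has degree above n and is 0, or its degree is an index
    of the family. *)
Lemma forms_of_inj eta eta' : bilinear_forms eta -> bilinear_forms eta' ->
  forms_of eta = forms_of eta' -> eta = eta'.
Proof.
move=> heta heta' ff'; apply: functional_extensionality_dep => p.
apply/funext => x; apply/funext => y.
have [etar etal _ _] := heta; have [etar' etal' _ _] := heta'.
elim/extalg_ind: x => [|a x x' hx hx'|s].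
- by rewrite (scalar_zero (etal p y)) (scalar_zero (etal' p y)).
- by rewrite (etal p) (etal' p) hx hx'.
elim/extalg_ind: y => [|a y y' hy hy'|t].
- by rewrite !bilinear_forms0.
- by rewrite (etar p) (etar' p) hy hy'.
have hs := extpow_prod s; have ht := extpow_prod t.
rewrite (bilinear_forms_mul heta hs ht) (bilinear_forms_mul heta' hs ht).
have hst := extpowM hs ht; set k := (_ + _)%N in hst.
have [nk|kn] := ltnP n k.
  by rewrite (tangent_extpow_gt nk hst) !bilinear_forms0.
have kP : (k < n.+1)%N by [].
have e1 := @forms_of_eval eta (Ordinal kP) p _ heta hst.
have e2 := @forms_of_eval eta' (Ordinal kP) p _ heta' hst.
by rewrite -[LHS]e1 -[RHS]e2 ff'.
Qed.

(** No homogeneous part of x * y is extracted: a k-form evaluates to 0 on the components of other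
    degrees. *)
Definition form_of omega : fiber_form M := fun p x y =>
  \sum_(k < n.+1) ext_eval (omega k p) (x * y).

Lemma form_of_bilinear omega : total_forms omega -> bilinear_forms (form_of omega).
Proof.
move=> homega; split=> [p x a y z|p y a x z|p k l m x y z _ _ _|k l X Y sX sY].
- rewrite /form_of mulr_sumr -big_split; apply: eq_bigr => k _.
  by rewrite mulrDr -scalerAr ext_eval_scalarr.
- rewrite /form_of mulr_sumr -big_split; apply: eq_bigr => k _.
  by rewrite mulrDl -scalerAl ext_eval_scalarr.
- by rewrite /form_of mulrA.
apply: smooth_fun_local => p _; have ip := chart_atP p; set i := chart_at p in ip.
exists (chart_dom i) => //; have oi : open (chart_dom i) by exact: chart_dom_open.
have [f [sf Xf]] := sX.2 i; have [g [sg Yg]] := sY.2 i.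
have /choice[h hh] : forall m : 'I_n.+1, exists h : {set 'I_n} -> M -> R,
    (forall C, smooth_fun_on (chart_dom i) (h C)) /\
    forall p, chart_dom i p -> omega m p =
      \sum_(C : {set 'I_n} | #|C| == m) h C p *: ext_frame (coord_covec i p) C.
  by move=> m; exact: (homega m).2.
(* Over the chart everything is expanded in the coordinate frames: the value is a finite sum of
   products of smooth coefficients with the structure constants of the wedge product. *)
apply: (@smooth_fun_ext _ _ _ _ (fun q => \sum_(m < n.+1)
  \sum_(C : {set 'I_n} | #|C| == m) h m C q *
  \sum_(A : {set 'I_n} | #|A| == k) f A q *
  \sum_(B : {set 'I_n} | #|B| == l) g B q *
    kronecker_pairing R (enum C) (enum A ++ enum B))) => //.
  move=> q iq; apply: eq_bigr => m _; rewrite (hh m).2 //.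
  rewrite (scalar_sumZ _ _ _ _ (ext_eval_scalarl _)).
  apply: eq_bigr => C _; congr (_ * _); rewrite Xf // Yg // mulr_suml.
  under [in RHS]eq_bigr do rewrite -scalerAl.
  rewrite (scalar_sumZ _ _ _ _ (ext_eval_scalarr _)).
  apply: eq_bigr => A _; congr (_ * _); rewrite mulr_sumr.
  under [in RHS]eq_bigr do rewrite -scalerAr.
  rewrite (scalar_sumZ _ _ _ _ (ext_eval_scalarr _)).
  apply: eq_bigr => B _; congr (_ * _).
  by rewrite ext_eval_frameM // => a b; exact: coord_covec_dual.
apply: smooth_fun_sum => // m _; apply: smooth_fun_sum => // C _.
apply: smooth_funM => //; first exact: (hh m).1.
apply: smooth_fun_sum => // A _; apply: smooth_funM => //.
apply: smooth_fun_sum => // B _; apply: smooth_funM => //.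
exact: smooth_fun_cst.
Qed.

(** Both sides have degree k, so it suffices to evaluate on k-vectors, where the terms of the other
    degrees vanish. *)
Lemma form_ofK omega : total_forms omega -> forms_of (form_of omega) = omega.
Proof.
move=> homega; apply: functional_extensionality_dep => k.
apply: functional_extensionality_dep => p.
have hk (m : 'I_n.+1) : extpow m (omega m p) by exact: (homega m).1.
apply: (@ext_eval_inj p k) => // [|x hx]; first exact: forms_of_extpow.
rewrite (forms_of_eval (form_of_bilinear homega) hx) /form_of mul1r (bigD1 k) //= big1 ?addr0 // => m mk.
exact: ext_eval_deg mk (hk m) hx.
Qed.

Lemma forms_of_associated eta : bilinear_forms eta -> associated eta (forms_of eta).
Proof.
move=> heta; have [etar etal _ _] := heta; split=> [p k l j x y jkl _ hx hy|p a b].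
  rewrite (bilinear_forms_mul heta hx hy) forms_of_eval // jkl.
  exact: extpowM.
(* In degree 0 the only index set is empty and its frame element is 1, so bilinearity of eta settles
   the scalar condition. *)
rewrite /forms_of (big_pred1 finset.set0) => [|A]; last exact: cards_eq0.
rewrite /ext_frame !big_set0 scalerA; congr (_ *: _).
by rewrite (scalar_scale _ _ (etal p b%:A)) (scalar_scale _ _ (etar p 1)) mulrA.
Qed.

Lemma associated_inj eta omega omega' : total_forms omega -> total_forms omega' ->
  associated eta omega -> associated eta omega' -> omega = omega'.
Proof.
move=> homega homega' [eo eo0] [eo' eo0'].
apply: functional_extensionality_dep => k; apply: functional_extensionality_dep => p.
(* Degree 0 is read off from the scalar condition at a = b = 1. Positive degree follows from the
   other condition applied to 1 and x, of degrees 0 and k. *)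
have [k0|k0] := posnP k.
  have -> : k = ord0 by exact: val_inj.
  have := eo0 p 1 1; have := eo0' p 1 1.
  by rewrite mulr1 !scale1r => -> ->.
apply: (@ext_eval_inj p k) => [||x hx]; [exact: (homega k).1|exact: (homega' k).1|].
have e1 : extpow 0 (1 : extalg (tangent p)) by exact: extpow1.
by rewrite -[x]mul1r -(eo p 0 k k) // -(eo' p 0 k k).
Qed.

End Correspondence.

Theorem proposition5p3 (R : realType) (n : nat) (M : smooth_manifold R n) :
  exists f : fiber_form M -> form_family M,
    set_bij (@bilinear_forms R n M) (@total_forms R n M) f /\
    forall (eta : fiber_form M) (omega : form_family M),
      bilinear_forms eta -> total_forms omega ->
      (f eta = omega <-> associated eta omega).
Proof.
exists (@forms_of R n M); split.
  split=> [eta|eta eta'|omega homega]; first exact: forms_of_total.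
    by rewrite !inE; exact: forms_of_inj.
  by exists (form_of omega); [exact: form_of_bilinear|exact: form_ofK].
(* The converse holds because [forms_of eta] is itself associated with eta and an associated family
   is unique. *)
move=> eta omega heta homega; split=> [<-|]; first exact: forms_of_associated.
exact: (associated_inj (forms_of_total heta) homega (forms_of_associated heta)).
Qed.
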